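(* Let $S$ be a $J$-frame operator in a Krein space $(\mathcal H,[\cdot,\cdot])$. Then, $T:\ell_2(I)\to\mathcal H$ is the synthesis operator of a $J$-frame such that $S=TT^+$ if and only if there exists a co-isometry $U:\ell_2(I)\to\mathcal H$ (between Krein spaces) such that $$T=S^{1/2}U.$$
   Context: Krein spaces (over $\mathbb C$). A Krein space $(\mathcal H,[\cdot,\cdot])$ is a vector space with a Hermitian sesquilinear form admitting a fundamental decomposition $\mathcal H=\mathcal H_+\,[\dotplus]\,\mathcal H_-$, i.e. a direct, $[\cdot,\cdot]$-orthogonal sum such that $(\mathcal H_+,[\cdot,\cdot])$ and $(\mathcal H_-,-[\cdot,\cdot])$ are Hilbert spaces. The associated Hilbert inner product is $\langle x_++x_-,y_++y_-\rangle=[x_+,y_+]-[x_-,y_-]$, with norm $\|\cdot\|$; the norms coming from different fundamental decompositions are equivalent, so the topology of $\mathcal H$ does not depend on the choice. For Krein spaces $\mathcal H,\mathcal K$ and a bounded operator $T:\mathcal H\to\mathcal K$, the adjoint $T^+:\mathcal K\to\mathcal H$ is the operator with $[Tx,y]=[x,T^+y]$ for all $x\in\mathcal H$, $y\in\mathcal K$. A bounded operator $U$ between Krein spaces is a co-isometry if $UU^+=I$. A subspace $\mathcal L$ is uniformly positive (negative) if there is $\alpha>0$ with $[x,x]\ge\alpha\|x\|^2$ (resp. $-[x,x]\ge\alpha\|x\|^2$) for all $x\in\mathcal L$; maximal means maximal with respect to inclusion among such subspaces. $J$-frames. A family $\mathcal F=\{f_i\}_{i\in I}$ in $\mathcal H$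 is a Bessel family if for some $\beta<\infty$ one has $\sum_{i\in I}|\langle f,f_i\rangle|^2\le\beta\|f\|^2$ for all $f\in\mathcal H$. Its synthesis operator is the bounded operator $T:\ell_2(I)\to\mathcal H$, $Tx=\sum_{i\in I}x_if_i$; thus $f_i=Te_i$, where $\{e_i\}_{i\in I}$ is the standard orthonormal basis of $\ell_2(I)$. Put $I_+=\{i\in I:[f_i,f_i]\ge0\}$, $I_-=\{i\in I:[f_i,f_i]<0\}$, and $T_\pm x=\sum_{i\in I_\pm}x_if_i$. The Bessel family $\mathcal F$ is a $J$-frame for $\mathcal H$ if the range $R(T_+)$ is a maximal uniformly positive subspace and the range $R(T_-)$ is a maximal uniformly negative subspace of $\mathcal H$. The coefficient space $\ell_2(I)$ is considered as a Krein space with the indefinite inner product induced by $\mathcal F$, $[x,y]_2=\sum_{i\in I_+}x_i\overline{y_i}-\sum_{i\in I_-}x_i\overline{y_i}$; adjoints and co-isometries involving $\ell_2(I)$ are understood with respect to $[\cdot,\cdot]_2$. The $J$-frame operator of a $J$-frame $\mathcal F$ is $TT^+f=\sum_{i\in I_+}[f,f_i]f_i-\sum_{i\in I_-}[f,f_i]f_i$, $f\in\mathcal H$. An operator $S$ is called a $J$-frame operator if it is the $J$-frame operator of some $J$-frame for $\mathcal H$. Square root. For a $J$-frame operator $S$, the spectrum $\sigma(S)$ lies in the open right half-plane, and $S^{1/2}=\frac1{2\pi i}\int_\Gamma z^{1/2}(z-S)^{-1}\,dz$, where $\Gamma$ is a Jordan curve in the right half-plane enclosing $\sigma(S)$ and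 $z^{1/2}$ is the analytic branch with $\operatorname{Re}z^{1/2}>0$ for $\operatorname{Re}z>0$. It is the unique bounded operator $P$ on $\mathcal H$ with $P^2=S$ and $\sigma(P)\subseteq\{re^{it}: r>0,\ t\in(-\pi/4,\pi/4)\}$; it is invertible and self-adjoint in the Krein space $\mathcal H$.
   Formalization: That T is the synthesis operator of a J-frame (inducing the Krein structure on ℓ2(I)) is assumed on both sides; the equivalence proved is S=TT^+ iff T=S^{1/2}U with U a co-isometry, since a co-isometry U alone need not make S^{1/2}U the synthesis operator of a J-frame. *)

(* Defs.v *)
From HB Require Import structures.
From mathcomp Require Import all_boot all_order all_algebra.
From mathcomp Require Import finmap complex ring.
From mathcomp Require Import all_classical all_reals all_analysis.

Set Implicit Arguments.
Unset Strict Implicit.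
Unset Printing Implicit Defensive.

Import Order.TTheory GRing.Theory Num.Theory.
Import ComplexField.Normc.

Local Open Scope classical_set_scope.
Local Open Scope complex_scope.
Local Open Scope ring_scope.

(* Unordered summation: the net of the finite partial sums of u converges to s
   with respect to the norm nrm. *)
Definition has_sum (R : realType) (I : choiceType) (W : zmodType)
    (nrm : W -> R) (u : I -> W) (s : W) : Prop :=
  forall e : R, 0 < e -> exists J0 : {fset I}, forall J : {fset I},
    (J0 `<=` J)%fset -> nrm (s - \sum_(i <- J) u i) < e.

Definition csum (R : realType) (I : choiceType) (u : I -> R[i]) : R[i] :=
  xget 0 [set s | has_sum (@normc R) u s].

Section Ell2.
Context {R : realType} {I : choiceType}.
Implicit Types x y : I -> R[i].

Definition sqsum x : \bar R :=
  \esum_(i in [set: I]) ((normc (x i)) ^+ 2)%:E.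

Definition ell2_pred : {pred I -> R[i]} := fun x => (sqsum x < +oo)%E.

Lemma normc_sqrD_le (z w : R[i]) :
  normc (z + w) ^+ 2 <= 2 * normc z ^+ 2 + 2 * normc w ^+ 2.
Proof.
case: z w => [a b] [c d] /=.
rewrite !sqr_sqrtr ?addr_ge0 ?sqr_ge0// -subr_ge0.
have -> : 2 * (a ^+ 2 + b ^+ 2) + 2 * (c ^+ 2 + d ^+ 2) -
  ((a + c) ^+ 2 + (b + d) ^+ 2) = (a - c) ^+ 2 + (b - d) ^+ 2 by ring.
by rewrite addr_ge0 ?sqr_ge0.
Qed.

Lemma esum_sqsum_fin (k : R) x : 0 <= k -> (sqsum x < +oo)%E ->
  (\esum_(i in [set: I]) (k * normc (x i) ^+ 2)%:E < +oo)%E.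
Proof.
move=> k0 hx; apply: (@le_lt_trans _ _ (k%:E * sqsum x)%E); last first.
  by apply: lte_mul_pinfty; rewrite ?lee_fin.
apply: ge_ereal_sup => _ [A /= [finA _] <-].
under eq_fsbigr do rewrite EFinM.
rewrite -ge0_mule_fsumr; last by move=> i; rewrite lee_fin sqr_ge0.
rewrite lee_pmul// ?lee_fin//; last by apply: ereal_sup_ubound; exists A.
by apply: fsume_ge0 => i _; rewrite lee_fin sqr_ge0.
Qed.

Lemma ell2_submod_closed : GRing.submod_closed ell2_pred.
Proof.
split.
  rewrite unfold_in /sqsum esum1 ?ltry// => i _.
  by rewrite [normc _]normc0 expr0n.
move=> a x y; rewrite !unfold_in => hx hy.
pose k := 2 * normc a ^+ 2.
have k0 : 0 <= k by rewrite mulr_ge0 ?sqr_ge0.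
pose p i : \bar R := (k * normc (x i) ^+ 2)%:E.
pose q i : \bar R := (2 * normc (y i) ^+ 2)%:E.
have axy i : (((normc ((a *: x + y) i)) ^+ 2)%:E <= p i + q i)%E.
  rewrite /p /q -EFinD lee_fin (le_trans (normc_sqrD_le _ _))//.
  rewrite lerD2r /k -mulrA ler_wpM2l//.
  by rewrite [X in X ^+ 2 <= _]normcM exprMn.
apply: (@le_lt_trans _ _ (\esum_(i in [set: I]) (p i + q i))%E).
  by apply: le_esum => i _.
have p0 i : (0 <= p i)%E by rewrite lee_fin mulr_ge0 ?sqr_ge0.
have q0 i : (0 <= q i)%E by rewrite lee_fin mulr_ge0 ?sqr_ge0.
by rewrite esumD//; apply: lte_add_pinfty; apply: esum_sqsum_fin.
Qed.

HB.instance Definition _ :=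
  GRing.isSubmodClosed.Build R[i] (I -> R[i]) ell2_pred ell2_submod_closed.

End Ell2.

(* The space ell_2(I) of square-summable complex families. *)
Record ell2 (R : realType) (I : choiceType) := Ell2 {
  ell2_val :> I -> R[i];
  ell2P : ell2_val \in @ell2_pred R I }.

HB.instance Definition _ (R : realType) (I : choiceType) :=
  [isSub for @ell2_val R I].
HB.instance Definition _ (R : realType) (I : choiceType) :=
  [Choice of ell2 R I by <:].
HB.instance Definition _ (R : realType) (I : choiceType) :=
  [SubChoice_isSubLmodule of ell2 R I by <:].

Definition ell2_norm (R : realType) (I : choiceType) (x : ell2 R I) : R :=
  Num.sqrt (fine (sqsum x)).

Section Operators.
Context {R : realType}.

Definition bounded_op (V W : lmodType R[i]) (nV : V -> R) (nW : W -> R)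
    (T : V -> W) : Prop :=
  exists M : R, forall x, nW (T x) <= M * nV x.

(* Tp is the adjoint T^+ of T for the (indefinite) forms on V and W. *)
Definition is_adjoint (V W : lmodType R[i]) (fV : V -> V -> R[i])
    (fW : W -> W -> R[i]) (T : V -> W) (Tp : W -> V) : Prop :=
  forall x y, fW (T x) y = fV x (Tp y).

Definition coisometry (V W : lmodType R[i]) (fV : V -> V -> R[i])
    (fW : W -> W -> R[i]) (nV : V -> R) (nW : W -> R)
    (U : {linear V -> W}) : Prop :=
  bounded_op nV nW U /\
  exists2 Up : {linear W -> V}, is_adjoint fV fW U Up & forall y, U (Up y) = y.

End Operators.

Section Krein.
Context {R : realType} {V : lmodType R[i]}.

Definition linear_subspace (L : set V) : Prop :=
  L 0 /\ forall (a : R[i]) x y, L x -> L y -> L (a *: x + y).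

(* (L, f) is a Hilbert space; completeness is phrased with the square f x x of
   the norm.  In the order of R[i], 0 < z entails that z is real. *)
Definition hilbert_on (L : set V) (f : V -> V -> R[i]) : Prop :=
  [/\ linear_subspace L,
      (forall x, L x -> x != 0 -> 0 < f x x) &
      (forall u : nat -> V, (forall n, L (u n)) ->
        (forall e : R, 0 < e -> exists N : nat, forall m n : nat,
          (N <= m)%N -> (N <= n)%N -> f (u m - u n) (u m - u n) < e%:C) ->
        exists2 l, L l & forall e : R, 0 < e -> exists N : nat,
          forall n : nat, (N <= n)%N -> f (u n - l) (u n - l) < e%:C)].

Variable form : {hermitian V for false & @Num.conj R[i]}.

(* (V, form) is a Krein space iff this type is inhabited. *)
Record fundamental_decomposition := FundamentalDecomposition {
  pos_space : set V;
  neg_space : set V;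
  pos_part : V -> V;
  neg_part : V -> V;
  pos_partP : forall x, pos_space (pos_part x);
  neg_partP : forall x, neg_space (neg_part x);
  part_sum : forall x, x = pos_part x + neg_part x;
  pos_neg_direct : forall x, pos_space x -> neg_space x -> x = 0;
  pos_neg_orth : forall x y, pos_space x -> neg_space y -> form x y = 0;
  pos_hilbert : hilbert_on pos_space form;
  neg_hilbert : hilbert_on neg_space (fun x y => - form x y) }.

Variable D : fundamental_decomposition.

Definition hilb (x y : V) : R[i] :=
  form (pos_part D x) (pos_part D y) - form (neg_part D x) (neg_part D y).

Definition knorm (x : V) : R := Num.sqrt (complex.Re (hilb x x)).

Definition unif_positive (L : set V) : Prop :=
  linear_subspace L /\ exists2 a : R, 0 < a &
    forall x, L x -> (a * knorm x ^+ 2)%:C <= form x x.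

Definition unif_negative (L : set V) : Prop :=
  linear_subspace L /\ exists2 a : R, 0 < a &
    forall x, L x -> (a * knorm x ^+ 2)%:C <= - form x x.

Definition maximal_for (P : set V -> Prop) (L : set V) : Prop :=
  P L /\ forall L', P L' -> L `<=` L' -> L' = L.

Section Frames.
Context {I : choiceType}.
Variable F : I -> V.

Definition bessel : Prop := exists b : R, forall f : V,
  (\esum_(i in [set: I]) ((normc (hilb f (F i))) ^+ 2)%:E
     <= (b * knorm f ^+ 2)%:E)%E.

Definition Ipos (i : I) : bool := 0 <= form (F i) (F i).
Definition Ineg (i : I) : bool := form (F i) (F i) < 0.

Definition is_synthesis (T : ell2 R I -> V) : Prop :=
  forall x : ell2 R I, has_sum knorm (fun i => x i *: F i) (T x).

(* The set of all sums of x_i f_i over the i in A, x in ell_2(I): for A = I_+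
   and A = I_- these are the ranges of T_+ and T_-. *)
Definition range_synthesis (A : pred I) : set V :=
  [set y | exists x : ell2 R I,
     has_sum knorm (fun i => if A i then x i *: F i else 0) y].

Definition Jframe : Prop :=
  [/\ bessel,
      maximal_for unif_positive (range_synthesis Ipos) &
      maximal_for unif_negative (range_synthesis Ineg)].

(* The indefinite inner product [x,y]_2 induced by the family F. *)
Definition ell2_form (x y : ell2 R I) : R[i] :=
  csum (fun i => if Ipos i then x i * Num.conj (y i) else 0)
  - csum (fun i => if Ineg i then x i * Num.conj (y i) else 0).

(* S = T T^+, the adjoint being taken for ell2_form and form. *)
Definition factors_as_TTp (T : {linear ell2 R I -> V}) (S : V -> V) : Prop :=
  exists2 Tp : {linear V -> ell2 R I},
    is_adjoint ell2_form form T Tp & forall f, S f = T (Tp f).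

End Frames.

Definition Jframe_operator (S : V -> V) : Prop :=
  exists (I : choiceType) (F : I -> V) (T : {linear ell2 R I -> V}),
    [/\ Jframe F, is_synthesis F T & factors_as_TTp F T S].

Definition is_resolvent (S : V -> V) (z : R[i]) (Q : {linear V -> V}) : Prop :=
  [/\ bounded_op knorm knorm Q,
      (forall x, z *: Q x - S (Q x) = x) &
      (forall x, Q (z *: x - S x) = x)].

Definition spectrum (S : V -> V) : set R[i] :=
  [set z | ~ exists Q, is_resolvent S z Q].

Definition cintegral (a b : R) (g : R -> R[i]) : R[i] :=
  (\int[lebesgue_measure]_(t in `[a, b]) complex.Re (g t))
  +i* (\int[lebesgue_measure]_(t in `[a, b]) complex.Im (g t)).

(* The integral of g along the circle c + r e^(it), t in [0, 2 pi]. *)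
Definition circle_integral (c r : R) (g : R[i] -> R[i]) : R[i] :=
  cintegral 0 (2 * pi) (fun t =>
    g (c%:C + r%:C * (cos t +i* sin t)) *
    ((0 +i* r) * (cos t +i* sin t))).

(* P = S^(1/2), as the Riesz-Dunford integral
     (2 pi i)^-1 \int_Gamma z^(1/2) (z - S)^-1 dz,
   taken in the weak sense (tested against form), with Gamma a positively
   oriented circle in the open right half-plane enclosing the spectrum of S.
   By Cauchy's theorem the integral is the same for all Jordan curves Gamma in
   the right half-plane enclosing the spectrum, and every compact subset of the
   right half-plane is enclosed by such a circle.  sqrtc is the principal
   branch: Re (sqrtc z) > 0 if Re z > 0. *)
Definition is_sqrt (S P : V -> V) : Prop :=
  bounded_op knorm knorm P /\
  exists (c r : R) (Q : R[i] -> {linear V -> V}),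
    [/\ 0 < r < c,
        (forall z, spectrum S z -> normc (z - c%:C) < r),
        (forall z, ~ spectrum S z -> is_resolvent S z (Q z)) &
        (forall x y, form (P x) y =
           (0 +i* (2 * pi))^-1 *
           circle_integral c r (fun z => sqrtc z * form (Q z x) y))].

End Krein.

(* Main.v *)
Require Import Defs.
From HB Require Import structures.
From mathcomp Require Import all_boot all_order all_algebra.
From mathcomp Require Import finmap complex ring lra.
From mathcomp Require Import cyclic separable cyclotomic.
From mathcomp Require Import all_classical all_reals all_analysis.

Set Implicit Arguments.
Unset Strict Implicit.
Unset Printing Implicit Defensive.

Import Order.TTheory GRing.Theory Num.Theory.
Import ComplexField.Normc.
Local Open Scope ring_scope.
Local Open Scope complex_scope.

(** Write P for S^(1/2).  Everything follows from three facts about P: it is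
    self-adjoint for the indefinite form, P^2 = S, and P has a bounded inverse.
    Given them, if S = T T^+ then U := P^-1 T is bounded, U^+ = T^+ P^-1, and
    U U^+ = P^-1 S P^-1 = I; conversely, if T = P U with U U^+ = I then
    T^+ = U^+ P and T T^+ = P U U^+ P = P^2 = S.

    The inverse is cheap: the contour encloses the spectrum and leaves 0 outside,
    so S is boundedly invertible, and P^-1 = P S^-1 once P^2 = S.

    The two other facts must be read off the contour integral on the circle
    |z - c| = r ([square_root_approx]).  Put K := (c - S) / r, so that
    z - S = - (r / v) (I - v K) for z = c - r / v; the exterior of the circle
    becomes the disc |v| <= 1, on which the resolvent G v := (I - v K)^-1
    exists.  On that closed disc:

    - the powers K^n tend to 0 in norm ([power_decay]); this is the part of the
      spectral radius formula that is needed.  It is proved by averaging G over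
      the n-th roots of unity;
    - hence G v is uniformly approximated by its geometric sums, and integrating
      a polynomial in 1 / v against G v over the unit circle yields the same
      polynomial in K ([circle_calculus]), because the only means to compute are
      those of powers of exp(it);
    - sqrt (c (1 - rho u)) with rho := r / c < 1 is uniformly approximated on
      |u| <= 1 by real polynomials p for which p^2 - c (1 - rho X) has small
      l1 norm of coefficients ([sqrt_poly_approx]).

    So P is a norm limit of the operators p(K).  These are self-adjoint, since K
    is self-adjoint and p is real, and p(K)^2 tends to c (1 - rho K) = S, since
    the powers of K are bounded and the residual is small in l1 norm.

    That S itself is bounded and self-adjoint comes from its factorization
    S = T T^+ by some Bessel family ([TTp_bounded], [TTp_selfadjoint]). *)

(** * The modulus of complex numbers *)

Section Complex.
Context {R : realType}.
Implicit Types z w : R[i].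

Lemma conj_conjc z : Num.conj z = z^*.
Proof. by []. Qed.

Lemma norm_normc z : `|z| = (normc z)%:C.
Proof. by []. Qed.

Lemma normc_real (a : R) : normc a%:C = `|a|.
Proof. by rewrite /= expr0n addr0 sqrtr_sqr. Qed.

Lemma normc_ge0 z : 0 <= normc z.
Proof. by case: z => a b; apply: sqrtr_ge0. Qed.

Lemma normc_conj z : normc (Num.conj z) = normc z.
Proof. by case: z => a b /=; rewrite sqrrN. Qed.

Lemma normcX z n : normc (z ^+ n) = normc z ^+ n.
Proof. by elim: n => [|n IH]; rewrite ?expr0 ?normc1// !exprS normcM IH. Qed.

Lemma normc_sum (J : Type) (s : seq J) (P : pred J) (u : J -> R[i]) :
  normc (\sum_(i <- s | P i) u i) <= \sum_(i <- s | P i) normc (u i).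
Proof.
elim/big_rec2: _ => [|i y x _ h]; first by rewrite normc0.
by rewrite (le_trans (le_normcD _ _))// lerD2l.
Qed.

Lemma normc_distC z w : normc (z - w) = normc (w - z).
Proof. by rewrite -normcN opprB. Qed.

Lemma Re_le_normc z : `|complex.Re z| <= normc z.
Proof. by have := normc_ge_Re z; rewrite norm_normc lecR. Qed.

Lemma Im_le_normc z : `|complex.Im z| <= normc z.
Proof.
case: z => a b /=; rewrite -sqrtr_sqr ler_sqrt ?lerDr ?sqr_ge0//.
by rewrite addr_ge0 ?sqr_ge0.
Qed.

Lemma normc_le_ReIm z : normc z <= `|complex.Re z| + `|complex.Im z|.
Proof.
case: z => a b /=; rewrite -[leRHS]ger0_norm ?addr_ge0// -sqrtr_sqr.
by rewrite ler_sqrt ?sqr_ge0// sqrrD !real_normK ?num_real// addrAC lerDl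
  mulrn_wge0// mulr_ge0.
Qed.

Lemma mul_conj_normc z : z * Num.conj z = (normc z ^+ 2)%:C.
Proof. by rewrite -normCK norm_normc -rmorphXn. Qed.

Lemma conj_mul_conj z w : Num.conj (z * Num.conj w) = w * Num.conj z.
Proof.
by case: z w => a b [c d]; apply/eqP; rewrite eq_complex /=; apply/andP;
  split; apply/eqP; ring.
Qed.

Lemma conj0 : Num.conj (0 : R[i]) = 0.
Proof. exact: rmorph0. Qed.

Lemma conjB z w : Num.conj (z - w) = Num.conj z - Num.conj w.
Proof. exact: rmorphB. Qed.

Lemma ReM_real (a : R) z : complex.Re (a%:C * z) = a * complex.Re z.
Proof. by case: z => c d /=; rewrite mul0r subr0. Qed.

End Complex.

(** * Positive semidefinite forms *)

Section SemiInner.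
Context {R : realType} {W : lmodType R[i]}.
Variable h : W -> W -> R[i].
Hypothesis h_lin : forall a x y z, h (a *: x + y) z = a * h x z + h y z.
Hypothesis h_herm : forall x y, h y x = Num.conj (h x y).
Hypothesis h_ge0 : forall x, 0 <= h x x.

Definition seminorm_of (x : W) : R := Num.sqrt (complex.Re (h x x)).

Local Notation nm := seminorm_of.

Lemma semi_linr a x y z : h z (a *: x + y) = Num.conj a * h z x + h z y.
Proof. by rewrite h_herm h_lin rmorphD rmorphM /= -!h_herm. Qed.

Let h0l z : h 0 z = 0.
Proof.
by have := h_lin (-1) 0 0 z; rewrite scaler0 addr0 mulN1r addNr.
Qed.

Let h0r z : h z 0 = 0.
Proof. by rewrite h_herm h0l rmorph0. Qed.

Lemma seminorm_sq x : h x x = (nm x ^+ 2)%:C.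
Proof.
have := h_ge0 x; rewrite /nm; case: (h x x) => a b.
by rewrite lecE /= => /andP[/eqP-> a0]; rewrite sqr_sqrtr.
Qed.

Lemma seminorm_ge0 x : 0 <= nm x.
Proof. exact: sqrtr_ge0. Qed.

(** Besides giving the triangle inequality of a Krein space norm, this is applied
    to finite sums of coefficients, where the form is degenerate; hence
    positivity is only assumed semidefinite. *)
Lemma semi_CauchySchwarz x y : normc (h x y) <= nm x * nm y.
Proof.
set d := h x y; set A := nm x; set B := nm y.
have q (a b : R[i]) : 0 <= a * Num.conj a * (A ^+ 2)%:C + a * Num.conj b * d
    + b * Num.conj a * Num.conj d + b * Num.conj b * (B ^+ 2)%:C.
  have := h_ge0 (a *: x + (b *: y + 0)).
  rewrite !h_lin !semi_linr !h0l !h0r !mulr0 !addr0.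
  rewrite -/d (h_herm x y) -/d !seminorm_sq -/A -/B => h0.
  by move: h0; congr (_ <= _); ring.
have := seminorm_ge0 y; rewrite -/B le_eqVlt => /orP[/eqP B0|B0]; last first.
  (* expand the positivity of h at B^2 x - d y *)
  have := q (B ^+ 2)%:C (- d).
  have -> : Num.conj (B ^+ 2)%:C = (B ^+ 2)%:C by exact: conjc_real.
  rewrite rmorphN /= => h0.
  have : 0 <= (B ^+ 2)%:C * ((A ^+ 2)%:C * (B ^+ 2)%:C - d * Num.conj d).
    by move: h0; congr (_ <= _); ring.
  rewrite mul_conj_normc -!rmorphM -rmorphB -rmorphM ler0c pmulr_rge0 ?exprn_gt0//.
  rewrite subr_ge0 -exprMn ler_sqr// nnegrE ?normc_ge0//.
  by rewrite mulr_ge0 ?seminorm_ge0// ltW.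
rewrite -B0 mulr0 leNgt; apply/negP => d0.
(* y has seminorm 0: positivity at x - (t / 2) d y is affine in t *)
have t0 (t : R) : t * normc d ^+ 2 <= A ^+ 2.
  have := q 1 (- (t / 2)%:C * d).
  have -> : Num.conj (- (t / 2)%:C * d) = - (t / 2)%:C * Num.conj d.
    rewrite (rmorphM Num.conj) (rmorphN Num.conj); congr (- _ * _).
    exact: conjc_real.
  rewrite -B0 rmorph1 expr0n /= => h0.
  have : 0 <= (A ^+ 2)%:C - (t / 2)%:C * (d * Num.conj d) *+ 2.
    by move: h0; congr (_ <= _); ring.
  rewrite mul_conj_normc -rmorphM -rmorphMn -rmorphB ler0c.
  by rewrite subr_ge0 -mulrnAl -mulr_natr divfK ?pnatr_eq0.
have := t0 ((A ^+ 2 + 1) / normc d ^+ 2).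
by rewrite divfK ?lt0r_neq0 ?exprn_gt0// gerDl ler10.
Qed.

Lemma seminormZ a x : nm (a *: x) = normc a * nm x.
Proof.
apply/eqP; rewrite -(@eqrXn2 _ 2)// ?seminorm_ge0// ?mulr_ge0 ?seminorm_ge0 ?normc_ge0//.
apply/eqP; apply: (@complexI R); rewrite -seminorm_sq exprMn.
rewrite rmorphM /= -seminorm_sq -mul_conj_normc.
have e z u : h (a *: z) u = a * h z u.
  by have := h_lin a z 0 u; rewrite h0l !addr0.
by rewrite e h_herm e rmorphM /= -h_herm mulrA.
Qed.

Lemma seminormD x y : nm (x + y) <= nm x + nm y.
Proof.
rewrite -(@ler_pXn2r _ 2)// ?nnegrE ?addr_ge0 ?seminorm_ge0//.
rewrite -lecR -seminorm_sq -(scale1r x) h_lin !semi_linr rmorph1 !mul1r !scale1r.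
rewrite addrA !seminorm_sq (h_herm x y).
have key (a b : R) (z : R[i]) :
    a%:C + z + Num.conj z + b%:C = (a + b + 2 * complex.Re z)%:C.
  case: z => u v; apply/eqP; rewrite eq_complex /=; apply/andP.
  by split; apply/eqP; ring.
rewrite key lecR sqrrD addrAC lerD2r lerD2l mulr_natl lerMn2r /=.
rewrite (le_trans (ler_norm _))// (le_trans (Re_le_normc _))//.
exact: semi_CauchySchwarz.
Qed.

End SemiInner.

(** * Seminorms *)

Section Seminorm.
Context {R : realType}.

Definition is_seminorm (W : lmodType R[i]) (nrm : W -> R) : Prop :=
  (forall x y, nrm (x + y) <= nrm x + nrm y) /\
  (forall a x, nrm (a *: x) = normc a * nrm x).

Context {W : lmodType R[i]}.
Variable nrm : W -> R.
Hypothesis nrmP : is_seminorm nrm.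
Implicit Types x y : W.

Lemma nrmD x y : nrm (x + y) <= nrm x + nrm y.
Proof. exact: nrmP.1. Qed.

Lemma nrmZ a x : nrm (a *: x) = normc a * nrm x.
Proof. exact: nrmP.2. Qed.

Lemma nrm0 : nrm 0 = 0.
Proof. by rewrite -(scale0r 0) nrmZ normc0 mul0r. Qed.

Lemma nrmN x : nrm (- x) = nrm x.
Proof. by rewrite -scaleN1r nrmZ normcN normc1 mul1r. Qed.

Lemma nrmB x y : nrm (x - y) <= nrm x + nrm y.
Proof. by rewrite (le_trans (nrmD _ _))// nrmN. Qed.

Lemma nrm_distC x y : nrm (x - y) = nrm (y - x).
Proof. by rewrite -nrmN opprB. Qed.

Lemma nrm_ge0 x : 0 <= nrm x.
Proof.
have := nrmB x x; rewrite subrr nrm0 -mulr2n pmulrn_lge0//.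
Qed.

Lemma nrm_sum (J : Type) (s : seq J) (P : pred J) (u : J -> W) :
  nrm (\sum_(i <- s | P i) u i) <= \sum_(i <- s | P i) nrm (u i).
Proof.
elim/big_rec2: _ => [|i y x _ h]; first by rewrite nrm0.
by rewrite (le_trans (nrmD _ _))// lerD2l.
Qed.

End Seminorm.

Lemma normc_seminorm {R : realType} : @is_seminorm R R[i]^o (@normc R).
Proof. by split; [exact: le_normcD|exact: normcM]. Qed.

(** The factor k absorbs the constants of an estimate, so that they need not be
    divided out of the error e beforehand. *)
Lemma le_eps {R : realFieldType} (a b k : R) : 0 <= k ->
  (forall e, 0 < e -> a <= b + k * e) -> a <= b.
Proof.
move=> k0 h; apply/ler_addgt0Pr => e e0.
have k1 : 0 < k + 1 by rewrite ltr_wpDl.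
apply: (le_trans (h (e / (k + 1)) _)); first by rewrite divr_gt0.
by rewrite lerD2l mulrCA ger_pMr// ler_pdivrMr// mul1r lerDl.
Qed.

(** * Krein space geometry *)

Section KreinGeometry.
Context {R : realType} {V : lmodType R[i]}.
Variable form : {hermitian V for false & @Num.conj R[i]}.

Lemma form_lin a x y z : form (a *: x + y) z = a * form x z + form y z.
Proof. exact: linearPl. Qed.

Lemma form_herm x y : form y x = Num.conj (form x y).
Proof. by rewrite hermC expr0 mul1r. Qed.

Lemma form_Bl x y z : form (x - y) z = form x z - form y z.
Proof. exact: linearBl. Qed.

Lemma form_Br x y z : form z (x - y) = form z x - form z y.
Proof. exact: linearBr. Qed.

Lemma form_Zl a x z : form (a *: x) z = a * form x z.
Proof. by have := form_lin a x 0 z; rewrite linear0l !addr0. Qed.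

Lemma form_Zr_real (a : R) x z : form z (a%:C *: x) = a%:C * form z x.
Proof.
rewrite form_herm form_Zl (form_herm z x).
by case: (form z x) => u v; apply/eqP; rewrite eq_complex /=; apply/andP;
  split; apply/eqP; ring.
Qed.

Variable D : fundamental_decomposition form.

Local Notation pp := (pos_part D).
Local Notation np := (neg_part D).

Lemma subspaceN (L : set V) x : linear_subspace L -> L x -> L (- x).
Proof. by move=> [L0 LD] Lx; rewrite -scaleN1r -[_ *: _]addr0; apply: LD. Qed.

Lemma decomposition_uniq u v : pos_space D u -> neg_space D v ->
  pp (u + v) = u /\ np (u + v) = v.
Proof.
move=> pu nv; case: (pos_hilbert D) => sp _ _; case: (neg_hilbert D) => sn _ _.
have e : pp (u + v) - u = v - np (u + v).
  by apply/eqP; rewrite subr_eq addrAC eq_sym subr_eq addrC -part_sum addrC.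
have p0 : pp (u + v) - u = 0.
  apply: (@pos_neg_direct _ _ _ D).
    rewrite -[pp _]scale1r; apply: sp.2; first exact: pos_partP.
    exact: subspaceN.
  rewrite e -[v]scale1r; apply: sn.2 => //.
  by apply: subspaceN => //; exact: neg_partP.
split; first exact/subr0_eq.
by apply/esym/subr0_eq; rewrite -e.
Qed.

(** The fundamental symmetry J of the decomposition: [x, y] = <x, J y>. *)
Definition fundsym (x : V) : V := pp x - np x.

Lemma fundsym_parts x : pp (fundsym x) = pp x /\ np (fundsym x) = - np x.
Proof.
case: (neg_hilbert D) => sn _ _.
by apply: decomposition_uniq; [|apply: subspaceN => //]; 
  [exact: pos_partP|exact: neg_partP].
Qed.

Lemma fundsymK x : fundsym (fundsym x) = x.
Proof.
by rewrite {1}/fundsym; have [-> ->] := fundsym_parts x; rewrite opprK -part_sum.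
Qed.

Lemma form_hilb x y : form x y = hilb D x (fundsym y).
Proof.
rewrite /hilb; have [-> ->] := fundsym_parts y.
rewrite {1}(part_sum D x) {1}(part_sum D y) linearDl /= !linearDr /= linearNr opprK.
rewrite (pos_neg_orth (pos_partP D x) (neg_partP D y)).
rewrite (form_herm (pp y) (np x)) (pos_neg_orth (pos_partP D y) (neg_partP D x)).
by rewrite rmorph0 addr0 add0r.
Qed.

Lemma hilb_form x y : hilb D x y = form x (fundsym y).
Proof. by rewrite form_hilb fundsymK. Qed.

Lemma hilb_lin a x y z : hilb D (a *: x + y) z = a * hilb D x z + hilb D y z.
Proof. by rewrite !hilb_form form_lin. Qed.

Lemma hilb_herm x y : hilb D y x = Num.conj (hilb D x y).
Proof. by rewrite /hilb rmorphB /= -!form_herm. Qed.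

Lemma hilb_ge0 x : 0 <= hilb D x x.
Proof.
case: (pos_hilbert D) => _ p0 _; case: (neg_hilbert D) => _ n0 _.
rewrite /hilb addr_ge0//.
  have [->|x0] := eqVneq (pp x) 0; first by rewrite linear0l.
  by apply/ltW/p0 => //; exact: pos_partP.
have [->|x0] := eqVneq (np x) 0; first by rewrite linear0l oppr0.
by apply/ltW/n0 => //; exact: neg_partP.
Qed.

Lemma hilb_eq0 x : hilb D x x = 0 -> x = 0.
Proof.
case: (pos_hilbert D) => _ p0 _; case: (neg_hilbert D) => _ n0 _.
have a0 : 0 <= form (pp x) (pp x).
  have [->|x0] := eqVneq (pp x) 0; first by rewrite linear0l.
  by apply/ltW/p0 => //; exact: pos_partP.
have b0 : 0 <= - form (np x) (np x).
  have [->|x0] := eqVneq (np x) 0; first by rewrite linear0l oppr0.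
  by apply/ltW/n0 => //; exact: neg_partP.
rewrite /hilb => /eqP; rewrite paddr_eq0// => /andP[/eqP pa /eqP na].
rewrite (part_sum D x).
have [->|x0] := eqVneq (pp x) 0; last first.
  by have := p0 _ (pos_partP D x) x0; rewrite pa ltxx.
have [->|x0] := eqVneq (np x) 0; first by rewrite addr0.
by have := n0 _ (neg_partP D x) x0; rewrite na ltxx.
Qed.

Local Notation nm := (knorm D).

Lemma knorm_ge0 x : 0 <= nm x.
Proof. exact: sqrtr_ge0. Qed.

Lemma knormD x y : nm (x + y) <= nm x + nm y.
Proof. exact: (seminormD hilb_lin hilb_herm hilb_ge0). Qed.

Lemma knormZ a x : nm (a *: x) = normc a * nm x.
Proof. exact: (seminormZ hilb_lin hilb_herm hilb_ge0). Qed.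

Lemma knorm_sq x : hilb D x x = (nm x ^+ 2)%:C.
Proof. exact: (seminorm_sq hilb_ge0). Qed.

Lemma hilb_CauchySchwarz x y : normc (hilb D x y) <= nm x * nm y.
Proof. exact: (semi_CauchySchwarz hilb_lin hilb_herm hilb_ge0). Qed.

Lemma knorm_eq0 x : nm x = 0 -> x = 0.
Proof. by move=> x0; apply: hilb_eq0; rewrite knorm_sq x0 expr0n. Qed.

Lemma knorm_fundsym x : nm (fundsym x) = nm x.
Proof.
rewrite /knorm /hilb; have [-> ->] := fundsym_parts x.
by rewrite linearNl linearNr opprK.
Qed.

Lemma form_bound x y : normc (form x y) <= nm x * nm y.
Proof. by rewrite form_hilb (le_trans (hilb_CauchySchwarz _ _))// knorm_fundsym. Qed.

(** The norm is attained on the test vector y := J x, so weak estimates against the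
    indefinite form, such as those for the weakly defined square root, give norm
    estimates. *)
Lemma knorm_dual e x : 0 <= e -> (forall y, normc (form x y) <= e * nm y) -> nm x <= e.
Proof.
move=> e0 h; have := h (fundsym x); rewrite -hilb_form knorm_sq knorm_fundsym normc_real.
rewrite ger0_norm ?sqr_ge0//.
have := knorm_ge0 x; rewrite le_eqVlt => /orP[/eqP<-//|x0].
by rewrite expr2 ler_pM2r.
Qed.

End KreinGeometry.

(** * Unordered sums and synthesis operators *)

Section Sums.
Context {R : realType} {I : choiceType}.
Local Open Scope fset_scope.

Lemma has_sum_uniq (W : lmodType R[i]) (nrm : W -> R) (u : I -> W) s s' :
  is_seminorm nrm -> has_sum nrm u s -> has_sum nrm u s' -> nrm (s - s') = 0.
Proof.
move=> N hs hs'; apply/eqP; rewrite eq_le nrm_ge0// andbT.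
apply: (@le_eps _ _ _ 2) => // e e0.
have [J1 h1] := hs e e0; have [J2 h2] := hs' e e0.
have := h1 (J1 `|` J2) (fsubsetUl _ _); have := h2 (J1 `|` J2) (fsubsetUr _ _).
set S := \sum_(i <- _) _ => a b.
have -> : s - s' = (s - S) - (s' - S) by rewrite opprB addrA addrNK.
rewrite add0r mulrDl !mul1r (le_trans (nrmB N _ _))// lerD// ltW//.
Qed.

Lemma has_sum_single (W : lmodType R[i]) (nrm : W -> R) (u : I -> W) (j : I) :
  is_seminorm nrm -> (forall i, i != j -> u i = 0) -> has_sum nrm u (u j).
Proof.
move=> N u0 e e0; exists [fset j] => J; rewrite fsub1set => jJ.
rewrite (big_fsetD1 j)//= big1_fset ?addr0 ?subrr ?nrm0//.
by move=> i; rewrite !inE => /andP[ij _] _; apply: u0.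
Qed.

Lemma csum_eq (u : I -> R[i]) s : has_sum (@normc R) u s -> csum u = s.
Proof.
move=> us; rewrite /csum; apply: xget_unique => // t ut.
apply/subr0_eq/eq0_normc.
exact: (@has_sum_uniq R[i]^o _ _ _ _ normc_seminorm ut us).
Qed.

(** Conjugation preserves summability both ways, and without it both sides are the
    default value 0. *)
Lemma csum_conj (u : I -> R[i]) :
  csum (fun i => Num.conj (u i)) = Num.conj (csum u).
Proof.
have conj_sum (v : I -> R[i]) s : has_sum (@normc R) v s ->
    has_sum (@normc R) (fun i => Num.conj (v i)) (Num.conj s).
  move=> h e e0; have [J hJ] := h e e0; exists J => J' /hJ.
  by rewrite -rmorph_sum -rmorphB normc_conj.
have [[s us]|nus] := pselect (exists s, has_sum (@normc R) u s).
  by rewrite (csum_eq us); apply: csum_eq; exact: conj_sum.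
rewrite /csum !xgetPN ?rmorph0// => s us; apply: nus; first by exists s.
exists (Num.conj s); have := conj_sum _ _ us.
by under eq_fun do rewrite conjCK.
Qed.

Lemma fset_sqsum_le (x : I -> R[i]) (J : {fset I}) :
  ((\sum_(i <- J) normc (x i) ^+ 2)%:E <= sqsum x)%E.
Proof.
apply: ereal_sup_ubound; exists [set` J]%classic; first by split=> //; exact: finite_fset.
by rewrite fsumEFin ?finite_fset// -fsbig_seq.
Qed.

Lemma ell2_norm_sq (x : ell2 R I) : (ell2_norm x ^+ 2)%:E = sqsum x.
Proof.
have fx : sqsum x \is a fin_num.
  rewrite ge0_fin_numE; first exact: (ell2P x).
  by apply: esum_ge0 => i _; rewrite lee_fin sqr_ge0.
rewrite sqr_sqrtr ?fineK//; apply: fine_ge0.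
by apply: esum_ge0 => i _; rewrite lee_fin sqr_ge0.
Qed.

Lemma ell2_norm_ge0 (x : ell2 R I) : 0 <= ell2_norm x.
Proof. exact: sqrtr_ge0. Qed.

Lemma fset_ell2_norm_le (x : ell2 R I) (J : {fset I}) :
  \sum_(i <- J) normc (x i) ^+ 2 <= ell2_norm x ^+ 2.
Proof. by rewrite -lee_fin ell2_norm_sq fset_sqsum_le. Qed.

Definition unit_fun (j : I) : I -> R[i] := fun i => (i == j)%:R.

Lemma unit_fun_ell2 j : unit_fun j \in @ell2_pred R I.
Proof.
have e i : (normc (unit_fun j i) ^+ 2)%:E =
    (if i \in [set j]%classic then 1 else 0)%E :> \bar R.
  rewrite /unit_fun; have [->|ij] := eqVneq i j.
    by rewrite mem_set// normc1 expr1n.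
  rewrite memNset; first by rewrite /= !expr0n addr0 sqrtr0 expr0n.
  by move=> /= ij'; rewrite ij' eqxx in ij.
rewrite unfold_in /sqsum; under eq_esum do rewrite e.
by rewrite -esum_mkcond esum_set1// ltry.
Qed.

Definition unit_vec (j : I) : ell2 R I := Ell2 (unit_fun_ell2 j).

End Sums.

Section FiniteCS.
Context {R : realType} {I : choiceType}.

Lemma fset_CauchySchwarz (J : {fset I}) (x y : I -> R[i]) :
  normc (\sum_(i <- J) x i * y i) <=
  Num.sqrt (\sum_(i <- J) normc (x i) ^+ 2) * Num.sqrt (\sum_(i <- J) normc (y i) ^+ 2).
Proof.
pose h (x y : I -> R[i]) : R[i] := \sum_(i <- J) x i * Num.conj (y i).
have hl a u v w : h (a *: u + v) w = a * h u w + h v w.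
  rewrite /h mulr_sumr -big_split/=; apply: eq_bigr => i _.
  by rewrite mulrDl mulrA.
have hh u v : h v u = Num.conj (h u v).
  rewrite /h rmorph_sum; apply: eq_bigr => i _.
  exact/esym/conj_mul_conj.
have hr u : h u u = (\sum_(i <- J) normc (u i) ^+ 2)%:C.
  by rewrite /h rmorph_sum; apply: eq_bigr => i _; rewrite mul_conj_normc.
have h0 u : 0 <= h u u.
  by rewrite hr ler0c sumr_ge0// => i _; rewrite sqr_ge0.
have -> : \sum_(i <- J) x i * y i = h x (fun i => Num.conj (y i)).
  by apply: eq_bigr => i _; rewrite conjCK.
have := semi_CauchySchwarz hl hh h0 x (fun i => Num.conj (y i)).
rewrite /seminorm_of !hr.
have -> : \sum_(i <- J) normc (Num.conj (y i)) ^+ 2 = \sum_(i <- J) normc (y i) ^+ 2.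
  by apply: eq_bigr => i _; rewrite normc_conj.
by [].
Qed.

End FiniteCS.

Section Synthesis.
Context {R : realType} {V : lmodType R[i]}.
Variable form : {hermitian V for false & @Num.conj R[i]}.
Variable D : fundamental_decomposition form.
Local Notation nm := (knorm D).

Lemma knorm_seminorm : is_seminorm nm.
Proof. by split; [exact: knormD|exact: knormZ]. Qed.

Let N := knorm_seminorm.

Context {I : choiceType}.
Variables (F : I -> V) (T : {linear ell2 R I -> V}).

Lemma ell2_form_herm (x y : ell2 R I) :
  ell2_form form F y x = Num.conj (ell2_form form F x y).
Proof.
rewrite /ell2_form conjB -!csum_conj.
by congr (_ - _); congr csum; apply/funext => i; case: ifP => _;
  rewrite ?conj_mul_conj// conj0.
Qed.

(** [T T^+ x, y] = [T^+ x, T^+ y]_2, which is hermitian in (x, y). *)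
Lemma TTp_selfadjoint (S : V -> V) : factors_as_TTp form F T S ->
  forall x y, form (S x) y = form x (S y).
Proof.
move=> [Tp TTp ST] x y.
rewrite ST TTp (form_herm form (S y) x) ST TTp ell2_form_herm.
by [].
Qed.

Hypothesis bF : bessel D F.

Lemma bessel_ge0 : exists2 b : R, 0 <= b & forall f : V,
  (\esum_(i in [set: I]) ((normc (hilb D f (F i))) ^+ 2)%:E
     <= (b * nm f ^+ 2)%:E)%E.
Proof.
have [b hb] := bF; exists (Num.max b 0); first by rewrite le_max lexx orbT.
move=> f; apply: (le_trans (hb f)); rewrite lee_fin ler_wpM2r ?sqr_ge0//.
by rewrite le_max lexx.
Qed.

(** A finite partial sum y satisfies |y|^2 = sum of x_i <f_i, y>, which the Bessel
    bound at y and the Cauchy-Schwarz inequality control by |x| |y|. *)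
Lemma synthesis_bounded : is_synthesis D F T ->
  exists2 M : R, 0 <= M & forall x, nm (T x) <= M * ell2_norm x.
Proof.
move=> hT; have [b b0 hb] := bessel_ge0.
exists (Num.sqrt b) => [|x]; first exact: sqrtr_ge0.
apply: (@le_eps _ _ _ 1) => // e e0; rewrite mul1r.
have [J /(_ J (fsubset_refl _)) hJ] := hT x e e0.
set y := \sum_(i <- J) _ in hJ.
have -> : T x = y + (T x - y) by rewrite addrC subrK.
rewrite (le_trans (nrmD N _ _))// lerD ?(ltW hJ)//.
have : nm y ^+ 2 <= Num.sqrt b * ell2_norm x * nm y.
  rewrite -[leLHS]ger0_norm ?sqr_ge0// -normc_real -knorm_sq.
  have -> : hilb D y y = \sum_(i <- J) x i * hilb D (F i) y.
    rewrite hilb_form {1}/y linear_sumlz /=; apply: eq_bigr => i _.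
    by rewrite linearZl_LR hilb_form.
  rewrite (le_trans (fset_CauchySchwarz _ _ _))//.
  rewrite [leRHS]mulrAC [leRHS]mulrC ler_pM ?sqrtr_ge0//.
    rewrite -[leRHS]ger0_norm ?ell2_norm_ge0// -sqrtr_sqr.
    by rewrite ler_sqrt ?sqr_ge0 ?fset_ell2_norm_le.
  rewrite -[X in _ <= _ * X]ger0_norm ?knorm_ge0// -sqrtr_sqr -sqrtrM//.
  rewrite ler_sqrt ?(mulr_ge0 b0 (sqr_ge0 _))// -lee_fin.
  apply: le_trans (hb y).
  under eq_bigr do rewrite (hilb_herm D y) normc_conj.
  exact: (fset_sqsum_le (fun i => hilb D y (F i))).
have := knorm_ge0 D y; rewrite le_eqVlt => /orP[/eqP<- _|y0].
  by rewrite mulr_ge0 ?sqrtr_ge0.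
by rewrite expr2 ler_pM2r.
Qed.

Lemma synthesis_unit j : is_synthesis D F T -> T (unit_vec j) = F j.
Proof.
move=> hT; apply/subr0_eq/(@knorm_eq0 _ _ _ D).
apply: (has_sum_uniq N (hT _)).
have /= := @has_sum_single R I V nm (fun i => unit_vec j i *: F i) j N.
rewrite /unit_fun eqxx scale1r; apply => i /negbTE ->.
by rewrite scale0r.
Qed.

(** The indefinite form against a unit vector reads off one coordinate up to a sign:
    [f_j, f_j] is real, so every index is in exactly one of I_+ and I_-. *)
Lemma ell2_form_unit j (y : ell2 R I) :
  normc (ell2_form form F (unit_vec j) y) = normc (y j).
Proof.
have s (b : pred I) : csum (fun i => if b i then unit_vec j i * Num.conj (y i) else 0)
    = if b j then Num.conj (y j) else 0.
  apply: csum_eq.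
  have := @has_sum_single R I R[i]^o (@normc R)
    (fun i => if b i then unit_vec j i * Num.conj (y i) else 0) j normc_seminorm.
  rewrite /= /unit_fun eqxx mul1r; apply => i /negbTE ->.
  by rewrite mul0r if_same.
rewrite /ell2_form !s.
have -> : Ineg form F j = ~~ Ipos form F j.
  rewrite /Ineg /Ipos -real_ltNge ?real0// realE.
  have := form_herm form (F j) (F j); case: (form _ _) => a b.
  move/(congr1 (@complex.Im R)) => /= /eqP; rewrite -subr_eq0 opprK -mulr2n mulrn_eq0 /= => /eqP ->.
  by rewrite !lecE /= eqxx /=; exact: le_total.
by case: Ipos; rewrite /= ?subr0 ?sub0r ?normcN normc_conj.
Qed.

(** The coordinates of T^+ f have the moduli |[f_j, f]| = |<J f, f_j>|, so the
    Bessel bound at J f controls the norm of T^+ f. *)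
Lemma TTp_bounded (S : V -> V) : is_synthesis D F T -> factors_as_TTp form F T S ->
  exists2 M : R, 0 <= M & forall x, nm (S x) <= M * nm x.
Proof.
move=> hT [Tp TTp ST]; have [M M0 hM] := synthesis_bounded hT.
have [b b0 hb] := bessel_ge0.
exists (M * Num.sqrt b) => [|f]; first by rewrite mulr_ge0 ?sqrtr_ge0.
rewrite ST (le_trans (hM _))// -mulrA ler_wpM2l//.
rewrite -[X in _ <= _ * X]ger0_norm ?knorm_ge0// -sqrtr_sqr -sqrtrM//.
rewrite -[leLHS]ger0_norm ?ell2_norm_ge0// -sqrtr_sqr.
rewrite ler_sqrt ?(mulr_ge0 b0 (sqr_ge0 _))// -lee_fin ell2_norm_sq.
have := hb (fundsym D f); rewrite knorm_fundsym; apply: le_trans.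
apply: le_esum => i _; rewrite lee_fin -(ell2_form_unit i (Tp f)) -TTp.
by rewrite synthesis_unit// hilb_herm normc_conj (form_hilb D).
Qed.

End Synthesis.

(** * Decay of powers from a bounded resolvent on the closed unit disc *)

Lemma expr_small {R : realType} (q : R) : 0 <= q -> q < 1 ->
  forall e, 0 < e -> exists n0, forall n, (n0 <= n)%N -> q ^+ n <= e.
Proof.
move=> q0 q1 e e0.
have : `|q| < 1 by rewrite ger0_norm.
move=> /cvg_expr /cvgrPdist_le /(_ e e0) [n0 _ h].
exists n0 => n /h /=; rewrite sub0r normrN ger0_norm// exprn_ge0//.
Qed.

Section DiscCompact.
Context {R : realType}.
Import numFieldNormedType.Exports.
Local Open Scope classical_set_scope.

(** Compactness of the closed unit disc, in the form in which it is used: a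
    monotone family of properties that hold locally with some bound M holds on
    the whole disc with one bound.  Discs are relative, as nothing is known of
    the resolvent outside of the unit disc. *)
Lemma disc_uniform_bound (P : R -> R[i] -> Prop) :
  (forall M M' v, M <= M' -> P M v -> P M' v) ->
  (forall v, normc v <= 1 -> exists2 d : R, 0 < d & exists M,
     forall w, normc w <= 1 -> normc (w - v) < d -> P M w) ->
  exists M, forall v, normc v <= 1 -> P M v.
Proof.
move=> Pmono Ploc.
pose sq : set (R * R) := `[-1, 1] `*` `[-1, 1].
pose disc : set (R * R) := [set p | p.1 ^+ 2 + p.2 ^+ 2 <= 1].
(* the disc as a subset of R^2, whose product topology is at hand *)
have cdisc : compact disc.
  apply: (@subclosed_compact _ _ sq).
  - rewrite (_ : disc = (fun p : R * R => p.1 ^+ 2 + p.2 ^+ 2) @^-1` [set x | x <= 1]) //.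
    apply: closed_comp; last exact: closed_le.
    move=> p _; apply: cvgD; apply: cvgM;
      by [apply: cvg_fst|apply: cvg_snd].
  - by apply: compact_setX; exact: segment_compact.
  - move=> [a b] /= h.
    split; rewrite /= in_itv /= -ler_norml -(@expr_le1 _ 2)// ?real_normK ?num_real//.
      by rewrite (le_trans _ h)// lerDl sqr_ge0.
    by rewrite (le_trans _ h)// lerDr sqr_ge0.
have [M hM] : exists M : R,
    disc `<=` [set p | normc (p.1 +i* p.2) <= 1 -> P M (p.1 +i* p.2)].
  have /compact_near_coveringP cov := cdisc.
  have [|M [_ hM]] := cov R (+oo)%R
      (fun M p => normc (p.1 +i* p.2) <= 1 -> P M (p.1 +i* p.2)) _ _; last first.
    by exists (M + 1); apply: hM; rewrite ltrDl.
  move=> [a b] h.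
  have v1 : normc (a +i* b) <= 1.
    by rewrite /= -[leRHS]sqrtr1 ler_sqrt.
  have [d d0 [M hM]] := Ploc _ v1.
  exists (ball (a, b) (d / 2), [set M' | M <= M']) => /=.
    split; first by apply: nbhsx_ballx; rewrite divr_gt0.
    by apply: nbhs_pinfty_ge; exact: num_real.
  move=> [[a' b'] M'] /= [[ha hb] MM'] w1; apply: (Pmono _ _ _ MM'); apply: hM => //.
  rewrite (le_lt_trans (normc_le_ReIm _))//= (splitr d) ltrD//.
    by rewrite distrC.
  by rewrite distrC.
exists M => -[a b] h; apply: (hM (a, b)) => //=.
by rewrite /disc /= -(@ler_sqrt _ _ 1)// sqrtr1.
Qed.

End DiscCompact.

Lemma prim_root_exists {R : realType} n : (n > 0)%N ->
  exists z : R[i], n.-primitive_root z.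
Proof.
pose p : {poly R[i]} := 'X^n - 1; have [r Dp] := closed_field_poly_normal p.
move=> n_gt0; rewrite (monicP _) ?monicXnsubC // scale1r in Dp.
have rn1 : all n.-unity_root r by apply/allP=> z; rewrite -root_prod_XsubC -Dp.
have sz_r : (n < (size r).+1)%N by rewrite -(size_prod_XsubC r id) -Dp size_XnsubC.
have [|z] := hasP (has_prim_root n_gt0 rn1 _ sz_r); last by exists z.
by rewrite -separable_prod_XsubC -Dp separable_Xn_sub_1 // pnatr_eq0 -lt0n.
Qed.

Lemma sum_prim_root_pow {R : realType} n (z : R[i]) j : n.-primitive_root z ->
  (j < n)%N -> \sum_(k < n) (z ^+ k) ^+ j = (if j == 0%N then n%:R else 0).
Proof.
move=> zn jn; case: eqP => [->|/eqP j0].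
  under eq_bigr do rewrite expr0.
  by rewrite sumr_const card_ord.
have zj : z ^+ j != 1.
  by rewrite -(prim_order_dvd zn) gtnNdvd// lt0n.
have : (z ^+ j - 1) * \sum_(k < n) (z ^+ k) ^+ j = 0.
  under eq_bigr do rewrite exprAC.
  by rewrite -subrX1 exprAC (prim_expr_order zn) expr1n subrr.
by move/eqP; rewrite mulf_eq0 subr_eq0 (negbTE zj) => /eqP.
Qed.

Section PowerDecay.
Context {R : realType} {W : lmodType R[i]}.
Variable nrm : W -> R.
Hypothesis N : is_seminorm nrm.
Variable K : {linear W -> W}.
Variable k : R.
Hypothesis k0 : 0 <= k.
Hypothesis Kb : forall x, nrm (K x) <= k * nrm x.
Variable G : R[i] -> W -> W.
Hypothesis GL : forall v, normc v <= 1 -> forall x, G v (x - v *: K x) = x.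
Hypothesis GR : forall v, normc v <= 1 -> forall x, G v x - v *: K (G v x) = x.
Hypothesis Gb : forall v, normc v <= 1 -> exists M, forall x, nrm (G v x) <= M * nrm x.

Lemma resolvent_sub v w x : normc v <= 1 -> normc w <= 1 ->
  G v x - G w x = G v ((v - w) *: K (G w x)).
Proof.
move=> v1 w1; rewrite -[LHS](GL v1); congr (G v _).
rewrite linearB scalerBr /=.
have -> : G v x - G w x - (v *: K (G v x) - v *: K (G w x)) =
  (G v x - v *: K (G v x)) - G w x + v *: K (G w x).
  by rewrite opprB addrCA addrC; congr (_ + _); exact: addrAC.
by rewrite GR// -{1}(GR w1 x) [X in X + _ = _]addrAC subrr sub0r scalerBl addrC.
Qed.

(** Inverses of linear maps are additive; G is a bare family of functions so that
    its value at v = 0 may be the identity. *)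
Lemma resolventD v x y : normc v <= 1 -> G v (x + y) = G v x + G v y.
Proof.
move=> v1; rewrite -[RHS](GL v1) linearD scalerDr opprD addrACA.
by rewrite !GR.
Qed.

(** If M bounds G v then 2 M bounds G w for w near v: in the resolvent identity the
    term containing G w has a small factor and is absorbed. *)
Lemma resolvent_uniform_bound : exists2 M : R, 0 <= M &
  forall v, normc v <= 1 -> forall x, nrm (G v x) <= M * nrm x.
Proof.
have [||M hM] := @disc_uniform_bound R (fun M v => forall x, nrm (G v x) <= M * nrm x).
- move=> M M' v MM' h x; rewrite (le_trans (h x))// ler_wpM2r//; exact: nrm_ge0.
- move=> v v1; have [M0 hM0] := Gb v1.
  pose M := Num.max M0 0.
  have M_ge0 : 0 <= M by rewrite le_max lexx orbT.
  have hM x : nrm (G v x) <= M * nrm x.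
    rewrite (le_trans (hM0 x))// ler_wpM2r//; first exact: nrm_ge0.
    by rewrite le_max lexx.
  have p0 : 0 < 2 * (M * k + 1) by rewrite mulr_gt0// ltr_wpDl// mulr_ge0.
  exists (2 * (M * k + 1))^-1; first by rewrite invr_gt0.
  exists (2 * M) => w w1 wv x.
  have h : nrm (G w x - G v x) <= 2^-1 * nrm (G w x).
    (* the radius 1 / (2 (M k + 1)) makes |w - v| M k at most 1 / 2 *)
    rewrite nrm_distC// resolvent_sub// (le_trans (hM _))// nrmZ// normc_distC.
    rewrite mulrCA (@le_trans _ _ (normc (w - v) * (M * (k * nrm (G w x)))))//.
      by rewrite ler_wpM2l ?normc_ge0// ler_wpM2l.
    rewrite 2!mulrA ler_wpM2r ?nrm_ge0// -mulrA.
    have Mk : 0 <= M * k by rewrite mulr_ge0.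
    apply: (@le_trans _ _ ((2 * (M * k + 1))^-1 * (M * k))).
      by rewrite ler_wpM2r// ltW.
    by rewrite invfM -mulrA ger_pMr// mulrC ler_pdivrMr ?mul1r ?lerDl// ltr_wpDl.
  have : nrm (G w x) <= M * nrm x + 2^-1 * nrm (G w x).
    rewrite -{1}[G w x](subrK (G v x)) (le_trans (nrmD N _ _))// addrC lerD//.
  rewrite -lerBlDr -[X in X - _]mul1r -mulrBl.
  have -> : 1 - 2^-1 = 2^-1 :> R by lra.
  by rewrite ler_pdivrMl// mulrA.
exists (Num.max M 0); first by rewrite le_max lexx orbT.
move=> v v1 x; rewrite (le_trans (hM v v1 x))// ler_wpM2r//; first exact: nrm_ge0.
by rewrite le_max lexx.
Qed.

Lemma resolvent_lipschitz : exists2 L : R, 0 < L &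
  forall v w x, normc v <= 1 -> normc w <= 1 ->
  nrm (G v x - G w x) <= L * normc (v - w) * nrm x.
Proof.
have [M M0 hM] := resolvent_uniform_bound.
exists (M * k * M + 1) => [|v w x v1 w1]; first by rewrite ltr_wpDl// !mulr_ge0.
rewrite resolvent_sub// (le_trans (hM _ v1 _))// nrmZ//.
have h : nrm (K (G w x)) <= k * (M * nrm x).
  by rewrite (le_trans (Kb _))// ler_wpM2l// hM.
apply: (@le_trans _ _ (M * (normc (v - w) * (k * (M * nrm x))))).
  by rewrite ler_wpM2l// ler_wpM2l ?normc_ge0.
have -> : M * (normc (v - w) * (k * (M * nrm x))) =
  M * k * M * normc (v - w) * nrm x by ring.
by rewrite ler_wpM2r ?nrm_ge0// ler_wpM2r ?normc_ge0// lerDl.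
Qed.

Lemma geometric_telescope u n x :
  let y := \sum_(j < n) u ^+ j *: iter j K x in
  y - u *: K y = x - u ^+ n *: iter n K x.
Proof.
rewrite /=; elim: n => [|n IH].
  by rewrite !big_ord0 linear0 scaler0 expr0 scale1r !subrr.
rewrite !big_ord_recr /= linearD /= scalerDr opprD addrACA IH.
by rewrite (linearZ_LR K) scalerA -exprS addrA subrK.
Qed.

Lemma resolvent_geometric u n x : normc u <= 1 ->
  G u (x - u ^+ n *: iter n K x) = \sum_(j < n) u ^+ j *: iter j K x.
Proof. by move=> u1; rewrite -geometric_telescope GL. Qed.

(** With z a primitive n-th root of unity this is the partial fraction expansion of
    (I - v^n K^n)^-1: see [root_mean_inverse]. *)
Definition root_mean (z : R[i]) (n : nat) (v : R[i]) (x : W) : W :=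
  n%:R^-1 *: \sum_(i < n) G (z ^+ i * v) x.

Lemma normc_prim_root n (z : R[i]) : n.-primitive_root z -> normc z = 1.
Proof.
move=> zn; apply/eqP; rewrite -(@pexpr_eq1 _ _ n) ?normc_ge0//.
  by rewrite -normcX (prim_expr_order zn) normc1.
exact: prim_order_gt0 zn.
Qed.

Lemma normc_root_mul n (z : R[i]) i v : n.-primitive_root z ->
  normc (z ^+ i * v) = normc v.
Proof. by move=> zn; rewrite normcM normcX (normc_prim_root zn) expr1n mul1r. Qed.

(** At (I - v^n K^n) x each G (z^i v) is a geometric sum in z^i v K, and averaging
    over i kills all powers of K but the zeroth. *)
Lemma root_mean_inverse n (z : R[i]) v x : n.-primitive_root z -> normc v <= 1 ->
  root_mean z n v (x - v ^+ n *: iter n K x) = x.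
Proof.
move=> zn v1; have n0 := prim_order_gt0 zn.
rewrite /root_mean.
have -> : \sum_(i < n) G (z ^+ i * v) (x - v ^+ n *: iter n K x) =
    \sum_(i < n) \sum_(j < n) (z ^+ i * v) ^+ j *: iter j K x.
  apply: eq_bigr => i _; rewrite -resolvent_geometric ?(normc_root_mul _ _ zn)//.
  by rewrite exprMn exprAC (prim_expr_order zn) expr1n mul1r.
rewrite exchange_big /= (bigD1 (Ordinal n0)) //= [X in _ + X]big1 => [|j j0].
  rewrite addr0; under eq_bigr do rewrite expr0 scale1r.
  by rewrite sumr_const card_ord -scalerMnr scalerMnl -mulr_natr mulVf ?scale1r// pnatr_eq0 -lt0n.
under eq_bigr do rewrite exprMn -scalerA.
by rewrite -scaler_suml (sum_prim_root_pow zn)// ifN ?scale0r.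
Qed.

Lemma root_meanD n z v x y : n.-primitive_root z -> normc v <= 1 ->
  root_mean z n v (x + y) = root_mean z n v x + root_mean z n v y.
Proof.
move=> zn v1; rewrite /root_mean -scalerDr -big_split /=; congr (_ *: _).
by apply: eq_bigr => i _; rewrite resolventD// (normc_root_mul _ _ zn).
Qed.

Lemma normc_natV n : normc (n%:R^-1 : R[i]) = n%:R^-1.
Proof.
by rewrite normcV -(rmorph_nat (real_complex R)) normc_real ger0_norm.
Qed.

Lemma mean_bound n (u : 'I_n -> W) c : (0 < n)%N ->
  (forall i, nrm (u i) <= c) -> nrm (n%:R^-1 *: \sum_(i < n) u i) <= c.
Proof.
move=> n0 h; rewrite nrmZ// normc_natV ler_pdivrMl ?ltr0n//.
rewrite (le_trans (nrm_sum N _ _ _))// mulr_natl.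
by rewrite -[X in _ *+ X]card_ord -sumr_const ler_sum.
Qed.

Definition small_power (t eps : R) (n : nat) :=
  forall x, nrm (t%:C ^+ n *: iter n K x) <= eps * nrm x.

Variables (M L : R).
Hypothesis M0 : 0 <= M.
Hypothesis hM : forall v, normc v <= 1 -> forall x, nrm (G v x) <= M * nrm x.
Hypothesis L0 : 0 < L.
Hypothesis hL : forall v w x, normc v <= 1 -> normc w <= 1 ->
  nrm (G v x - G w x) <= L * normc (v - w) * nrm x.

(** The key to the decay of powers.  Let J t be the mean of G over the n-th roots of
    unity times t, which inverts I - t^n K^n.  If t^n K^n is small then J t is
    near I; as G is Lipschitz, J t' is also near I for t' near t, uniformly in n; then
    t'^n K^n = (J t' - I) (I - t'^n K^n) is small again. *)
Lemma small_power_transfer t t' eps n : (0 < n)%N -> 0 <= eps -> 0 <= t <= 1 -> 0 <= t' <= 1 ->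
  small_power t eps n ->
  let eta := L * `|t - t'| + M * eps in
  eta <= 2^-1 -> small_power t' (2 * eta) n.
Proof.
move=> n0 eps0 /andP[t0 t1] /andP[t0' t1'] h eta eta2 x.
have [z zn] := @prim_root_exists R n n0.
have tC : normc t%:C <= 1 by rewrite normc_real ger0_norm.
have tC' : normc t'%:C <= 1 by rewrite normc_real ger0_norm.
have mean_near y : nrm (root_mean z n t'%:C y - y) <= eta * nrm y.
  pose c := t%:C ^+ n *: iter n K y.
  have -> : root_mean z n t'%:C y - y =
      (root_mean z n t'%:C y - root_mean z n t%:C y) + root_mean z n t%:C c.
    have e : root_mean z n t%:C y = y + root_mean z n t%:C c.
      by rewrite -{1}(subrK c y) (root_meanD _ _ zn)// (root_mean_inverse _ zn).
    by rewrite e opprD addrA subrK.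
  rewrite (le_trans (nrmD N _ _))// /eta mulrDl lerD//.
    rewrite /root_mean -scalerBr -sumrB; apply: mean_bound => // i.
    rewrite (le_trans (hL _ _ _))// ?(normc_root_mul _ _ zn)//.
    rewrite -mulrBr (normc_root_mul _ _ zn) -rmorphB normc_real distrC.
    exact: lexx.
  apply: mean_bound => // i.
  rewrite (le_trans (hM _ _))// ?(normc_root_mul _ _ zn)// -mulrA ler_wpM2l//.
  exact: h.
set d := t'%:C ^+ n *: iter n K x.
have e : d = root_mean z n t'%:C (x - d) - (x - d).
  by rewrite (root_mean_inverse _ zn)// opprB addrC subrK.
have h1 : nrm d <= eta * (nrm x + nrm d).
  rewrite {1}e (le_trans (mean_near _))// ler_wpM2l ?nrmB//.
  by rewrite addr_ge0// mulr_ge0// ltW.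
have := nrm_ge0 N x; have := nrm_ge0 N d.
move: h1 eta2; set a := nrm d; set b := nrm x; nra.
Qed.

Let good t := forall eps, 0 < eps -> exists n0, forall n, (n0 <= n)%N -> small_power t eps n.

Let good0 : good 0.
Proof.
move=> eps e0; exists 1%N => n n0 x.
by rewrite expr0n -(negbK (n == 0%N)) -lt0n n0 scale0r nrm0// mulr_ge0 ?nrm_ge0// ltW.
Qed.

(** Transferring from t to t' only bounds t'^n K^n; the factor (s / t')^n then brings
    it to 0 for s < t'.  The step length depends on L only, so finitely many
    steps lead from 0 to any t < 1. *)
Let good_step t t' s : 0 <= t <= 1 -> 0 <= s < t' -> t' <= 1 ->
  L * `|t - t'| <= 4^-1 -> good t -> good s.
Proof.
move=> t01 /andP[s0 st'] t'1 hd ht.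
have t'0 : 0 < t' by apply: le_lt_trans st'.
have p0 : 0 < 4 * M + 1 by rewrite ltr_wpDl// mulr_ge0.
have eps0 : 0 < (4 * M + 1)^-1 by rewrite invr_gt0.
have [n1 h1] := ht _ eps0.
have q0 : 0 <= s / t' by rewrite divr_ge0// ltW.
have q1 : s / t' < 1 by rewrite ltr_pdivrMr// mul1r.
move=> eps e0; have [n2 h2] := expr_small q0 q1 e0.
exists (maxn 1 (maxn n1 n2)) => n; rewrite !geq_max => /and3P[n0 nn1 nn2] x.
have /= hs := small_power_transfer n0 (ltW eps0) t01 _ (h1 n nn1).
have Me : M * (4 * M + 1)^-1 <= 4^-1.
  by rewrite ler_pdivrMr// mulrDr mulrA mulVf ?pnatr_eq0// mul1r lerDl.
have e2 : L * `|t - t'| + M * (4 * M + 1)^-1 <= 2^-1.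
  by apply: (le_trans (lerD hd Me)); lra.
have h := hs t' _ e2 x.
have {}h : nrm (t'%:C ^+ n *: iter n K x) <= 1 * nrm x.
  apply: le_trans (h _) _; first by rewrite t'1 ltW.
  by rewrite ler_wpM2r ?nrm_ge0//; lra.
have -> : s%:C ^+ n *: iter n K x = ((s / t') ^+ n)%:C *: (t'%:C ^+ n *: iter n K x).
  rewrite scalerA -!(rmorphXn (real_complex R)) -(rmorphM (real_complex R)) -exprMn.
  by rewrite divfK ?gt_eqF.
rewrite nrmZ// normc_real ger0_norm ?exprn_ge0//.
by rewrite ler_pM ?exprn_ge0 ?nrm_ge0 ?h2// -[leRHS]mul1r.
Qed.

Let good_lt1 t : 0 <= t < 1 -> good t.
Proof.
have d0 : 0 < (4 * L)^-1 by rewrite invr_gt0 mulr_gt0.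
set d := (4 * L)^-1 in d0.
have Ld : L * d = 4^-1 by rewrite /d invfM mulrCA mulfV ?mulr1// gt_eqF.
suff H m : forall t, 0 <= t < 1 -> t <= m%:R * (d / 2) -> good t.
  have d2 : 0 < d / 2 by rewrite divr_gt0.
  move=> /andP[t0 t1]; apply: (H (Num.bound (t / (d / 2)))); first by rewrite t0.
  by rewrite -ler_pdivrMr// ltW// archi_boundP// divr_ge0// ltW.
elim: m => [|m IH] {}t /andP[t0 t1] tm.
  suff -> : t = 0 by exact: good0.
  by apply/eqP; rewrite eq_le t0 andbT (le_trans tm)// mul0r.
pose a := Num.max (t - d / 2) 0.
pose b := Num.min (a + d) 1.
have ta : t <= a + d / 2 by rewrite -lerBlDr le_max lexx.
have a1 : 0 <= a < 1.
  by rewrite /a le_max lexx orbT gt_max ltr01 andbT ltrBlDr ltr_wpDr// ltW// divr_gt0.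
case/andP: (a1) => a_ge0 a_lt1.
apply: (@good_step a b).
- by rewrite a_ge0 ltW.
- by rewrite t0 lt_min t1 andbT; apply: (le_lt_trans ta); lra.
- by rewrite ge_min lexx orbT.
- rewrite -Ld ler_wpM2l ?(ltW L0)// distrC ger0_norm.
    by rewrite lerBlDl ge_min lexx.
  by rewrite subr_ge0 le_min lerDl ltW//= ltW.
- apply: IH => //; rewrite ge_max; apply/andP; split.
    by rewrite lerBlDr; move: tm; rewrite -natr1 mulrDl mul1r.
  by rewrite mulr_ge0// ltW// divr_gt0.
Qed.

(** At the endpoint there is no room for a geometric factor; instead the transfer
    starts from t < 1 arbitrarily close to 1, which makes the error small. *)
Let good1 : good 1.
Proof.
move=> eps e0.
pose e := Num.min (eps / 4) 4^-1.
have e_gt0 : 0 < e by rewrite lt_min divr_gt0 //= invr_gt0.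
have e4 : e <= 4^-1 by rewrite ge_min lexx orbT.
have ee : e <= eps / 4 by rewrite ge_min lexx.
pose t := Num.max (1 - e / L) 0.
have t01 : 0 <= t < 1.
  by rewrite le_max lexx orbT gt_max ltr01 andbT ltrBlDr ltrDl divr_gt0.
case/andP: (t01) => t0 t1.
have p0 : 0 < M + 1 by rewrite ltr_wpDl.
have [n0 h0] := good_lt1 t01 (divr_gt0 e_gt0 p0).
exists (maxn 1 n0) => n; rewrite geq_max => /andP[n1 nn0] x.
have h1 : L * `|t - 1| <= e.
  rewrite distrC ger0_norm ?subr_ge0 ?(ltW t1)// mulrC -ler_pdivlMr// lerBlDr addrC -lerBlDr.
  by rewrite le_max lexx.
have h2 : M * (e / (M + 1)) <= e.
  by rewrite mulrCA ger_pMr// ler_pdivrMr// mul1r lerDl.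
have := small_power_transfer n1 (ltW (divr_gt0 e_gt0 p0)) _ _ (h0 n nn0).
move=> /(_ 1 _ _ _ x) h.
apply: le_trans (h _ _ _) _; rewrite ?t0 ?ler01 ?lexx ?(ltW t1)//.
  by apply: (le_trans (lerD h1 h2)); lra.
rewrite ler_wpM2r ?nrm_ge0//; lra.
Qed.

Lemma power_decay_of_bounds eps : 0 < eps -> exists n0, forall n, (n0 <= n)%N ->
  forall x, nrm (iter n K x) <= eps * nrm x.
Proof.
move=> /good1 [n0 h]; exists n0 => n /h h' x.
by have := h' x; rewrite expr1n scale1r.
Qed.

End PowerDecay.

(** On a Banach space the hypotheses say that the spectral radius of K is less than
    1, and the conclusion is what the spectral radius formula gives.  The proof
    walks along the segment of v from 0 to 1 ([small_power_transfer]). *)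
Theorem power_decay {R : realType} {W : lmodType R[i]} (nrm : W -> R)
    (K : {linear W -> W}) (k : R) (G : R[i] -> W -> W) :
  is_seminorm nrm -> 0 <= k -> (forall x, nrm (K x) <= k * nrm x) ->
  (forall v, normc v <= 1 -> forall x, G v (x - v *: K x) = x) ->
  (forall v, normc v <= 1 -> forall x, G v x - v *: K (G v x) = x) ->
  (forall v, normc v <= 1 -> exists M, forall x, nrm (G v x) <= M * nrm x) ->
  forall eps, 0 < eps -> exists n0, forall n, (n0 <= n)%N ->
  forall x, nrm (iter n K x) <= eps * nrm x.
Proof.
move=> N k0 Kb GL GR Gb.
have [M M0 hM] := resolvent_uniform_bound N k0 Kb GL GR Gb.
have [L L0 hL] := resolvent_lipschitz N k0 Kb GL GR Gb.
exact: (power_decay_of_bounds N GL GR M0 hM L0 hL).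
Qed.

(** * Polynomial approximation of the square root *)

Section PolyL1.
Context {R : realType}.
Implicit Types p q : {poly R}.

(** This norm dominates both the values of p on the closed unit disc and the norm of
    p(K), up to a bound on the powers of K. *)
Definition poly_l1 p : R := \sum_(i < size p) `|p`_i|.

Lemma poly_l1_widen p n : (size p <= n)%N -> poly_l1 p = \sum_(i < n) `|p`_i|.
Proof.
move=> pn; rewrite /poly_l1 (big_ord_widen _ (fun i => `|p`_i|) pn) big_mkcond /=.
apply: eq_bigr => i _; case: ltnP => // pi.
by rewrite nth_default// normr0.
Qed.

Lemma poly_l1_ge0 p : 0 <= poly_l1 p.
Proof. exact: sumr_ge0. Qed.

Lemma poly_l1D p q : poly_l1 (p + q) <= poly_l1 p + poly_l1 q.
Proof.
rewrite (@poly_l1_widen (p + q) (maxn (size p) (size q)) (size_polyD _ _)).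
rewrite (poly_l1_widen (leq_maxl (size p) (size q))).
rewrite (poly_l1_widen (leq_maxr (size p) (size q))) -big_split /=.
by apply: ler_sum => i _; rewrite coefD ler_normD.
Qed.

Lemma poly_l1Z a p : poly_l1 (a *: p) = `|a| * poly_l1 p.
Proof.
rewrite (@poly_l1_widen (a *: p) (size p) (size_scale_leq _ _)) mulr_sumr.
by apply: eq_bigr => i _; rewrite coefZ normrM.
Qed.

Definition nonneg_coefs p := forall i, 0 <= p`_i.

Lemma nonneg_coefs_l1 p : nonneg_coefs p -> poly_l1 p = p.[1].
Proof.
move=> p0; rewrite horner_coef; apply: eq_bigr => i _.
by rewrite expr1n mulr1 ger0_norm.
Qed.

Lemma nonneg_coefs0 : nonneg_coefs 0.
Proof. by move=> i; rewrite coef0. Qed.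

Lemma nonneg_coefsD p q : nonneg_coefs p -> nonneg_coefs q -> nonneg_coefs (p + q).
Proof. by move=> p0 q0 i; rewrite coefD addr_ge0. Qed.

Lemma nonneg_coefsM p q : nonneg_coefs p -> nonneg_coefs q -> nonneg_coefs (p * q).
Proof. by move=> p0 q0 i; rewrite coefM sumr_ge0// => j _; rewrite mulr_ge0. Qed.

Lemma nonneg_coefsZ a p : 0 <= a -> nonneg_coefs p -> nonneg_coefs (a *: p).
Proof. by move=> a0 p0 i; rewrite coefZ mulr_ge0. Qed.

Lemma nonneg_coefsX : nonneg_coefs 'X.
Proof. by move=> i; rewrite coefX ler0n. Qed.

Definition ceval p (u : R[i]) : R[i] := (map_poly (real_complex R) p).[u].

Lemma ceval_sum p u : ceval p u = \sum_(i < size p) (p`_i)%:C * u ^+ i.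
Proof.
rewrite /ceval horner_coef size_map_poly; apply: eq_bigr => i _.
by rewrite coef_map.
Qed.

Lemma ceval_bound p u : normc u <= 1 -> normc (ceval p u) <= poly_l1 p.
Proof.
move=> u1; rewrite ceval_sum (le_trans (normc_sum _ _ _))// ler_sum// => i _.
by rewrite normcM normc_real normcX ler_piMr// exprn_ile1 ?normc_ge0.
Qed.

(** Iterating y <- (rho X + y^2) / 2 from 0 computes 1 - sqrt (1 - rho X). *)
Fixpoint sqrt_iter (rho : R) n : {poly R} :=
  if n is m.+1 then 2^-1 *: (rho *: 'X + sqrt_iter rho m ^+ 2) else 0.

Section SqrtIter.
Variable rho : R.
Hypothesis rho0 : 0 <= rho.
Hypothesis rho1 : rho < 1.
Local Notation y := (sqrt_iter rho).
Local Notation q := (1 - Num.sqrt (1 - rho)).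

(** Hence, by induction, the increments have nonnegative coefficients, and their l1
    norm is their value at 1, where they decay geometrically. *)
Lemma sqrt_iter_gap n : y n.+2 - y n.+1 = 2^-1 *: ((y n.+1 - y n) * (y n.+1 + y n)).
Proof.
rewrite -subr_sqr /= -scalerBr; congr (_ *: _).
by rewrite opprD addrACA subrr add0r.
Qed.

Lemma sqrt_iter_ge0 n : nonneg_coefs (y n).
Proof.
elim: n => [|n IH]; first exact: nonneg_coefs0.
apply: nonneg_coefsZ; first by rewrite invr_ge0.
apply: nonneg_coefsD; first by apply: nonneg_coefsZ => //; exact: nonneg_coefsX.
by rewrite expr2; apply: nonneg_coefsM.
Qed.

Lemma sqrt_iter_gap_ge0 n : nonneg_coefs (y n.+1 - y n).
Proof.
elim: n => [|n IH]; first by rewrite subr0; exact: sqrt_iter_ge0.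
rewrite sqrt_iter_gap; apply: nonneg_coefsZ; first by rewrite invr_ge0.
by apply: nonneg_coefsM => //; apply: nonneg_coefsD; exact: sqrt_iter_ge0.
Qed.

Let sq : Num.sqrt (1 - rho) ^+ 2 = 1 - rho.
Proof. by rewrite sqr_sqrtr// subr_ge0 ltW. Qed.

Let s0 : 0 < Num.sqrt (1 - rho).
Proof. by rewrite sqrtr_gt0 subr_gt0. Qed.

Let s1 : Num.sqrt (1 - rho) <= 1.
Proof. by rewrite -[leRHS]sqrtr1 ler_sqrt// gerBl. Qed.

(** The bound 1 - sqrt (1 - rho) is the fixed point of s <- (rho + s^2) / 2. *)
Lemma sqrt_iter_le n : 0 <= (y n).[1] <= q.
Proof.
elim: n => [|n /andP[h0 hq]] /=.
  by rewrite horner0 lexx subr_ge0.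
rewrite !hornerE /=; apply/andP; split.
  by rewrite mulr_ge0 ?invr_ge0// addr_ge0// sqr_ge0.
move: h0 hq sq s0; set a := (y n).[1]; set b := Num.sqrt _; nra.
Qed.

Lemma sqrt_iter_gap_le n : (y n.+1 - y n).[1] <= q ^+ n.
Proof.
elim: n => [|n IH].
  rewrite subr0 expr0 (le_trans (proj2 (andP (sqrt_iter_le 1))))// gerBl ltW//.
rewrite sqrt_iter_gap !(hornerZ, hornerM) exprSr.
have -> : (y n.+1 + y n).[1] = (y n.+1).[1] + (y n).[1] by rewrite hornerD.
have /andP[a0 aq] := sqrt_iter_le n; have /andP[b0 bq] := sqrt_iter_le n.+1.
rewrite mulrCA ler_pM//.
- by rewrite -nonneg_coefs_l1 ?poly_l1_ge0//; exact: sqrt_iter_gap_ge0.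
- by rewrite mulr_ge0 ?invr_ge0 ?addr_ge0.
- by lra.
Qed.

(** This turns the decay of the increments into smallness of the residual. *)
Lemma sqrt_iter_residual n :
  (1 - y n) ^+ 2 - (1 - rho *: 'X) = 2 *: (y n.+1 - y n).
Proof.
rewrite /= scalerBr scalerA mulfV ?pnatr_eq0// scale1r scaler_nat mulr2n.
move: (rho *: 'X) (y n) => a b; ring.
Qed.

End SqrtIter.
Lemma sqrtc_Re_ge0 (z : R[i]) : 0 <= complex.Re (sqrtc z).
Proof. by case: z => a b /=; exact: sqrtr_ge0. Qed.

Lemma cevalD p q u : ceval (p + q) u = ceval p u + ceval q u.
Proof. by rewrite /ceval rmorphD hornerD. Qed.

Lemma cevalN p u : ceval (- p) u = - ceval p u.
Proof. by rewrite /ceval rmorphN hornerN. Qed.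

Lemma cevalM p q u : ceval (p * q) u = ceval p u * ceval q u.
Proof. by rewrite /ceval rmorphM hornerM. Qed.

Lemma cevalZ a p u : ceval (a *: p) u = a%:C * ceval p u.
Proof. by rewrite /ceval map_polyZ hornerZ. Qed.

Lemma ceval1 u : ceval 1 u = 1.
Proof. by rewrite /ceval rmorph1 hornerC. Qed.

Lemma cevalX u : ceval 'X u = u.
Proof. by rewrite /ceval map_polyX hornerX. Qed.

(** The approximant is p := sqrt c (1 - y_n).  With a the principal root and b := p u,
    (a - b) (a + b) is the small residual of p, while |a + b| stays away from 0
    because Re a >= 0 and Re b >= sqrt (c (1 - rho)); this is also what selects
    the right branch. *)
Theorem sqrt_poly_approx (c rho eps : R) : 0 < c -> 0 <= rho < 1 -> 0 < eps ->
  exists p : {poly R},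
  [/\ forall u, normc u <= 1 ->
        normc (sqrtc (c%:C * (1 - rho%:C * u)) - ceval p u) <= eps,
      poly_l1 (p ^+ 2 - c *: (1 - rho *: 'X)) <= eps &
      poly_l1 p <= 2 * Num.sqrt c].
Proof.
move=> c0 /andP[rho0 rho1] e0.
have rc : 0 < Num.sqrt c by rewrite sqrtr_gt0.
have rr : 0 < Num.sqrt (1 - rho) by rewrite sqrtr_gt0 subr_gt0.
pose q := 1 - Num.sqrt (1 - rho).
have q1 : q < 1 by rewrite gtrBl.
have q0 : 0 <= q by rewrite subr_ge0 -[leRHS]sqrtr1 ler_sqrt// gerBl.
pose m := Num.sqrt c * Num.sqrt (1 - rho).
have m0 : 0 < m by rewrite mulr_gt0.
have c2 : 0 < c * 2 by rewrite mulr_gt0.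
have d0 : 0 < Num.min eps (eps * m) / (c * 2).
  by rewrite divr_gt0// lt_min e0 mulr_gt0.
have [n /(_ n (leqnn n)) hn] := expr_small q0 q1 d0.
set y := sqrt_iter rho n.
have ly : poly_l1 y <= q.
  rewrite nonneg_coefs_l1; last exact: sqrt_iter_ge0.
  by have /andP[] := sqrt_iter_le rho0 rho1 n.
exists (Num.sqrt c *: (1 - y)).
have res : (Num.sqrt c *: (1 - y)) ^+ 2 - c *: (1 - rho *: 'X) =
    (c * 2) *: (sqrt_iter rho n.+1 - y).
  by rewrite exprZn sqr_sqrtr ?(ltW c0)// -scalerBr sqrt_iter_residual scalerA.
have lres : poly_l1 ((Num.sqrt c *: (1 - y)) ^+ 2 - c *: (1 - rho *: 'X)) <=
    Num.min eps (eps * m).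
  rewrite res poly_l1Z ger0_norm ?(ltW c2)// nonneg_coefs_l1; last first.
    exact: sqrt_iter_gap_ge0.
  rewrite -ler_pdivlMl// mulrC (le_trans _ hn)//.
  exact: sqrt_iter_gap_le.
split.
- move=> u u1; set a := sqrtc _; set b := ceval _ u.
  have ab : (a - b) * (a + b) =
      - ceval ((Num.sqrt c *: (1 - y)) ^+ 2 - c *: (1 - rho *: 'X)) u.
    rewrite -subr_sqr /a sqr_sqrtc !expr2.
    rewrite !(cevalD, cevalN, cevalM, cevalZ (Num.sqrt c), cevalZ c, cevalZ rho, ceval1, cevalX).
    by rewrite /b cevalZ cevalD cevalN ceval1 opprB.
  have mb : m <= normc (a + b).
    apply: le_trans (Re_le_normc _); apply: le_trans (ler_norm _).
    have -> : complex.Re (a + b) = complex.Re a + complex.Re b by case: (a) (b) => ? ? [].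
    rewrite -[leLHS]add0r lerD ?sqrtc_Re_ge0// /b cevalZ ReM_real ler_pM2l//.
    rewrite cevalD cevalN ceval1.
    have -> : complex.Re (1 - ceval y u) = 1 - complex.Re (ceval y u).
      by case: (ceval y u).
    rewrite lerBrDl -lerBrDr (le_trans (ler_norm _))//.
    by rewrite (le_trans (Re_le_normc _))// (le_trans (ceval_bound _ u1)).
  have ab0 : 0 < normc (a + b) by apply: lt_le_trans mb.
  rewrite -(ler_pM2r ab0) -normcM ab normcN (le_trans (ceval_bound _ u1))//.
  rewrite (le_trans lres)// ge_min; apply/orP; right.
  by rewrite ler_pM2l.
- by rewrite (le_trans lres)// ge_min lexx.
- rewrite poly_l1Z ger0_norm ?(ltW rc)// mulrC ler_pM2r//.
  rewrite (le_trans (poly_l1D _ _))// -(scaleN1r y) poly_l1Z normrN1 mul1r.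
  have -> : poly_l1 1 = 1 by rewrite /poly_l1 size_poly1 big_ord1 coef1 normr1.
  by apply: (@le_trans _ _ (1 + q)); [rewrite lerD2l|lra].
Qed.

End PolyL1.

(** * Polynomials in an operator *)

Section OperatorPoly.
Context {R : realType} {W : lmodType R[i]}.
Variable K : {linear W -> W}.
Implicit Types p q : {poly R}.

Definition peval p (x : W) : W := \sum_(i < size p) (p`_i)%:C *: iter i K x.

Lemma peval_widen p n x : (size p <= n)%N ->
  peval p x = \sum_(i < n) (p`_i)%:C *: iter i K x.
Proof.
move=> pn; rewrite /peval (big_ord_widen _ (fun i => (p`_i)%:C *: iter i K x) pn).
rewrite big_mkcond /=; apply: eq_bigr => i _; case: ltnP => // pi.
by rewrite nth_default// scale0r.
Qed.

Lemma iter_lin n a x y : iter n K (a *: x + y) = a *: iter n K x + iter n K y.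
Proof. by elim: n => //= n ->; rewrite linearP. Qed.

Lemma peval_lin p a x y : peval p (a *: x + y) = a *: peval p x + peval p y.
Proof.
rewrite /peval scaler_sumr -big_split; apply: eq_bigr => i _ /=.
by rewrite iter_lin scalerDr !scalerA mulrC.
Qed.

Lemma pevalB_arg p x y : peval p (x - y) = peval p x - peval p y.
Proof. by rewrite addrC -scaleN1r peval_lin scaleN1r addrC. Qed.

Lemma pevalD p q x : peval (p + q) x = peval p x + peval q x.
Proof.
rewrite (peval_widen x (size_polyD p q)).
rewrite (peval_widen x (leq_maxl (size p) (size q))).
rewrite (peval_widen x (leq_maxr (size p) (size q))) -big_split /=.
by apply: eq_bigr => i _; rewrite coefD (rmorphD (real_complex R)) scalerDl.
Qed.

Lemma pevalZ a p x : peval (a *: p) x = a%:C *: peval p x.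
Proof.
rewrite (peval_widen x (size_scale_leq a p)) scaler_sumr.
by apply: eq_bigr => i _; rewrite coefZ (rmorphM (real_complex R)) scalerA.
Qed.

Lemma pevalN p x : peval (- p) x = - peval p x.
Proof. by rewrite -(scaleN1r p) pevalZ (rmorphN1 (real_complex R)) scaleN1r. Qed.

Lemma pevalC a x : peval a%:P x = a%:C *: x.
Proof.
by rewrite (peval_widen x (size_polyC_leq1 a)) big_ord1 coefC.
Qed.

Lemma peval1 x : peval 1 x = x.
Proof. by rewrite pevalC scale1r. Qed.

Lemma pevalMX p x : peval (p * 'X) x = peval p (K x).
Proof.
have s : (size (p * 'X)%R <= (size p).+1)%N.
  by rewrite (leq_trans (size_polyMleq _ _))// size_polyX addn2.
rewrite (peval_widen x s) big_ord_recl coefMX scale0r add0r /peval.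
by apply: eq_bigr => i _; rewrite coefMX -iterSr.
Qed.

Lemma pevalX x : peval 'X x = K x.
Proof. by rewrite -['X]mul1r pevalMX peval1. Qed.

Lemma peval_comm p x : peval p (K x) = K (peval p x).
Proof.
rewrite /peval linear_sum; apply: eq_bigr => i _.
by rewrite (linearZ_LR K) -iterSr.
Qed.

Lemma pevalM p q x : peval (p * q) x = peval p (peval q x).
Proof.
elim/poly_ind: p x => [|p c IH] x.
  by rewrite mul0r !(pevalC 0) scale0r scale0r.
rewrite mulrDl mulrAC !pevalD !pevalMX IH peval_comm mul_polyC pevalZ pevalC.
by [].
Qed.

Lemma peval_bound (nrm : W -> R) C p x : is_seminorm nrm ->
  (forall i, nrm (iter i K x) <= C) -> nrm (peval p x) <= poly_l1 p * C.
Proof.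
move=> N h; rewrite /peval (le_trans (nrm_sum N _ _ _))// mulr_suml ler_sum// => i _.
by rewrite nrmZ// normc_real ler_wpM2l.
Qed.

End OperatorPoly.

(** * Means over the circle *)

Section CircleMean.
Context {R : realType}.
Import numFieldNormedType.Exports.
Local Open Scope classical_set_scope.
Local Notation mu := lebesgue_measure.
Local Notation I2 := (`[(0:R), 2 * pi]%classic).

Let twopi_gt0 : 0 < 2 * pi :> R.
Proof. by rewrite mulr_gt0// pi_gt0. Qed.

Lemma circle_integrable (f : R -> R) : continuous f -> mu.-integrable I2 (EFin \o f).
Proof.
move=> cf; apply: continuous_compact_integrable; first exact: segment_compact.
exact: continuous_subspaceT.
Qed.

Lemma circle_Rintegral_cst (a : R) : \int[mu]_(t in I2) a = a * (2 * pi).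
Proof.
rewrite Rintegral_cst//= lebesgue_measure_itv /= lte_fin twopi_gt0 /=.
by rewrite subr0.
Qed.

Lemma circle_Rintegral_dist (f g : R -> R) (e : R) : continuous f -> continuous g ->
  (forall t, `|f t - g t| <= e) ->
  `|\int[mu]_(t in I2) f t - \int[mu]_(t in I2) g t| <= e * (2 * pi).
Proof.
move=> cf cg fg.
have If := circle_integrable cf; have Ig := circle_integrable cg.
have cfg : continuous (fun t => f t - g t).
  by move=> t; apply: cvgB; [exact: cf|exact: cg].
rewrite -RintegralB//; apply: (le_trans (le_normr_Rintegral _ _)) => //.
  exact: circle_integrable.
rewrite -circle_Rintegral_cst; apply: le_Rintegral => //.
- by apply: circle_integrable => t; apply: cvg_norm; exact: cfg.
- by apply: circle_integrable => t; exact: cvg_cst.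
Qed.

Lemma Rintegral_FTC (F f : R -> R) : (forall t : R, is_derive t (1 : R) F (f t)) ->
  continuous f -> \int[mu]_(t in I2) f t = F (2 * pi) - F 0.
Proof.
move=> dF cf.
have cF : continuous F.
  by move=> t; apply/differentiable_continuous/derivable1_diffP; case: (dF t).
rewrite /Rintegral (@continuous_FTC2 _ f F)//.
- exact: continuous_subspaceT.
- split.
  + by move=> t _; case: (dF t).
  + by apply: cvg_at_right_filter; exact: cF.
  + by apply: cvg_at_left_filter; exact: cF.
- by move=> t _; rewrite derive1E; case: (dF t).
Qed.

Lemma cos_sin_period n : cos (n%:R * (2 * pi)) = 1 :> R /\ sin (n%:R * (2 * pi)) = 0 :> R.
Proof.
elim: n => [|n [c s]]; first by rewrite mul0r cos0 sin0.
have -> : n.+1%:R * (2 * pi) = n%:R * (2 * pi) + pi *+ 2 :> R.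
  by rewrite -natr1 mulrDl mul1r (mulr_natl pi 2).
by rewrite cosD2pi sinD2pi.
Qed.

Lemma is_derive_dilate (f : R -> R) (a d t : R) :
  is_derive (a * t) (1 : R) f d ->
  is_derive t (1 : R) (fun t => a^-1 * f (a * t)) (a^-1 * (d * a)).
Proof.
move=> df.
have h1 : is_derive t (1 : R) (a \*: (@id R)) (a *: (1 : R)).
  exact: is_deriveZ.
have h2 := is_derive1_comp df h1.
have h3 := is_deriveZ a^-1 h2.
by move: h3; rewrite /GRing.scale /= mulr1.
Qed.

Lemma Rintegral_cos n : (0 < n)%N -> \int[mu]_(t in I2) cos (n%:R * t) = 0 :> R.
Proof.
move=> n0; have nn : n%:R != 0 :> R by rewrite pnatr_eq0 -lt0n.
have dF (t : R) : is_derive t (1 : R) (fun t => n%:R^-1 * sin (n%:R * t)) (cos (n%:R * t)).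
  have := is_derive_dilate (is_derive_sin (n%:R * t)).
  by rewrite mulrCA mulVf// mulr1.
rewrite (Rintegral_FTC dF).
- by rewrite (cos_sin_period n).2 !mulr0 sin0 !mulr0 subrr.
- move=> t; apply: continuous_comp; last exact: continuous_cos.
  by apply: cvgM; [exact: cvg_cst|exact: cvg_id].
Qed.

Lemma Rintegral_sin n : \int[mu]_(t in I2) sin (n%:R * t) = 0 :> R.
Proof.
have [->|n0] := posnP n.
  under eq_Rintegral do rewrite mul0r sin0.
  by rewrite circle_Rintegral_cst mul0r.
have nn : n%:R != 0 :> R by rewrite pnatr_eq0 -lt0n.
have dF (t : R) : is_derive t (1 : R) (fun t => n%:R^-1 * (- cos (n%:R * t))) (sin (n%:R * t)).
  have dc := is_deriveN (is_derive_cos (n%:R * t)).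
  have := @is_derive_dilate (- cos) _ _ _ dc.
  by rewrite opprK mulrCA mulVf// mulr1.
rewrite (Rintegral_FTC dF).
- by rewrite (cos_sin_period n).1 mulr0 cos0 subrr.
- move=> t; apply: continuous_comp; last exact: continuous_sin.
  by apply: cvgM; [exact: cvg_cst|exact: cvg_id].
Qed.

(** Continuity is stated for the real and imaginary parts, as the contour integral
    is defined through them. *)
Definition ccontinuous (f : R -> R[i]) : Prop :=
  continuous (fun t => complex.Re (f t)) /\ continuous (fun t => complex.Im (f t)).

Definition circle_mean (f : R -> R[i]) (m : R[i]) : Prop :=
  ccontinuous f /\ cintegral 0 (2 * pi) f = (2 * pi)%:C * m.

Lemma ccontinuousD f g : ccontinuous f -> ccontinuous g ->
  ccontinuous (fun t => f t + g t).
Proof.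
move=> [fr fi] [gr gi]; split => t.
  rewrite (_ : (fun t => _) = fun t => complex.Re (f t) + complex.Re (g t)).
    by apply: cvgD; [exact: fr|exact: gr].
  by apply/funext => s; case: (f s) (g s) => ? ? [].
rewrite (_ : (fun t => _) = fun t => complex.Im (f t) + complex.Im (g t)).
  by apply: cvgD; [exact: fi|exact: gi].
by apply/funext => s; case: (f s) (g s) => ? ? [].
Qed.

Lemma ccontinuousM f g : ccontinuous f -> ccontinuous g ->
  ccontinuous (fun t => f t * g t).
Proof.
move=> [fr fi] [gr gi]; split => t.
  rewrite (_ : (fun t => _) = fun t => complex.Re (f t) * complex.Re (g t) -
      complex.Im (f t) * complex.Im (g t)).
    by apply: cvgB; apply: cvgM; [exact: fr|exact: gr|exact: fi|exact: gi].
  by apply/funext => s; case: (f s) (g s) => ? ? [].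
rewrite (_ : (fun t => _) = fun t => complex.Re (f t) * complex.Im (g t) +
    complex.Im (f t) * complex.Re (g t)).
  by apply: cvgD; apply: cvgM; [exact: fr|exact: gi|exact: fi|exact: gr].
by apply/funext => s; case: (f s) (g s) => ? ? [].
Qed.

Lemma ccontinuous_cst (a : R[i]) : ccontinuous (fun=> a).
Proof. by split=> t; exact: cvg_cst. Qed.

Lemma circle_meanD f g m n : circle_mean f m -> circle_mean g n ->
  circle_mean (fun t => f t + g t) (m + n).
Proof.
move=> [cf fm] [cg gn]; split; first exact: ccontinuousD.
have -> : (2 * pi)%:C * (m + n) = cintegral 0 (2 * pi) f + cintegral 0 (2 * pi) g.
  by rewrite fm gn mulrDr.
rewrite /cintegral; have [[fr fi] [gr gi]] := (cf, cg).
apply/eqP; rewrite eq_complex /=; apply/andP; split; apply/eqP.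
  rewrite -RintegralD ?circle_integrable//; apply: eq_Rintegral => t _.
  by case: (f t) (g t) => ? ? [].
rewrite -RintegralD ?circle_integrable//; apply: eq_Rintegral => t _.
by case: (f t) (g t) => ? ? [].
Qed.

Lemma circle_meanZ a f m : circle_mean f m -> circle_mean (fun t => a * f t) (a * m).
Proof.
move=> [cf fm]; split; first exact: (ccontinuousM (ccontinuous_cst a)).
have -> : (2 * pi)%:C * (a * m) = a * cintegral 0 (2 * pi) f by rewrite fm mulrCA.
rewrite /cintegral; have [fr fi] := cf.
have cZ (b : R) (g : R -> R) : continuous g -> continuous (fun t => b * g t).
  by move=> cg t; apply: cvgM; [exact: cvg_cst|exact: cg].
apply/eqP; rewrite eq_complex; case: a => a b /=; apply/andP; split; apply/eqP.
  rewrite -!RintegralZl ?circle_integrable// -RintegralB ?circle_integrable//;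
    try exact: cZ.
  by apply: eq_Rintegral => t _; case: (f t).
rewrite -!RintegralZl ?circle_integrable// -RintegralD ?circle_integrable//;
  try exact: cZ.
by apply: eq_Rintegral => t _; case: (f t).
Qed.

Lemma circle_mean_ext f g m : (forall t, f t = g t) -> circle_mean f m -> circle_mean g m.
Proof. by move=> /funext ->. Qed.

Lemma circle_mean_cst a : circle_mean (fun=> a) a.
Proof.
split; first exact: ccontinuous_cst.
rewrite /cintegral !circle_Rintegral_cst; case: a => a b /=.
by apply/eqP; rewrite eq_complex /= !mul0r subr0 addr0 ![2 * pi * _]mulrC !eqxx.
Qed.

Lemma circle_mean_sum n (f : 'I_n -> R -> R[i]) (m : 'I_n -> R[i]) :
  (forall i, circle_mean (f i) (m i)) ->
  circle_mean (fun t => \sum_(i < n) f i t) (\sum_(i < n) m i).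
Proof.
elim: n f m => [|n IH] f m h.
  rewrite big_ord0; apply: (circle_mean_ext _ (circle_mean_cst 0)) => t.
  by rewrite big_ord0.
rewrite big_ord_recr /=.
have hn := IH _ _ (fun i => h (widen_ord (leqnSn n) i)).
apply: (circle_mean_ext _ (circle_meanD hn (h ord_max))) => t.
by rewrite big_ord_recr.
Qed.

Definition cis (t : R) : R[i] := cos t +i* sin t.

Lemma cisX n t : cis t ^+ n = cis (n%:R * t).
Proof.
elim: n => [|n IH]; first by rewrite mul0r /cis cos0 sin0.
rewrite exprS IH -natr1 mulrDl mul1r addrC /cis cosD sinD.
by apply/eqP; rewrite eq_complex /= eqxx addrC eqxx.
Qed.

Lemma normc_cis t : normc (cis t) = 1.
Proof. by rewrite /= cos2Dsin2 sqrtr1. Qed.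

Lemma cis_conj t : cis t * Num.conj (cis t) = 1.
Proof. by rewrite mul_conj_normc normc_cis expr1n. Qed.

Lemma ccontinuous_cisX n : ccontinuous (fun t => cis t ^+ n).
Proof.
have c : continuous (fun t : R => n%:R * t).
  by move=> t; apply: cvgM; [exact: cvg_cst|exact: cvg_id].
split; under eq_fun do rewrite cisX /=.
  by move=> t; apply: continuous_comp; [exact: c|exact: continuous_cos].
by move=> t; apply: continuous_comp; [exact: c|exact: continuous_sin].
Qed.

Lemma circle_mean_cisX n : circle_mean (fun t => cis t ^+ n) (n == 0%N)%:R.
Proof.
have [->|n0] := posnP n; first exact: circle_mean_cst.
split; first exact: ccontinuous_cisX.
rewrite mulr0 /cintegral; under eq_Rintegral do rewrite cisX /=.
rewrite Rintegral_cos//; under eq_Rintegral do rewrite cisX /=.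
by rewrite Rintegral_sin.
Qed.

Lemma circle_mean_conj f m : circle_mean f m ->
  circle_mean (fun t => Num.conj (f t)) (Num.conj m).
Proof.
move=> [[fr fi] fm].
have e t : Num.conj (f t) = complex.Re (f t) -i* complex.Im (f t).
  by rewrite conj_conjc; case: (f t).
have cN : continuous (fun t => - complex.Im (f t)).
  by move=> t; apply: cvgN; exact: fi.
split; first by split; under eq_fun do rewrite e /=.
have -> : (2 * pi)%:C * Num.conj m = Num.conj ((2 * pi)%:C * m).
  case: (m) => a b; apply/eqP; rewrite eq_complex /=.
  by apply/andP; split; apply/eqP; ring.
rewrite -fm /cintegral conj_conjc /=; congr (_ +i* _).
  by apply: eq_Rintegral => t _; rewrite e.
rewrite -mulN1r -RintegralZl ?circle_integrable//; apply: eq_Rintegral => t _.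
by rewrite e /= mulN1r.
Qed.

(** For z = c + r exp(it) on the contour, the variable v of z = c - r / v is
    - exp(-it) and its inverse is - exp(it). *)
Definition vcirc (t : R) : R[i] := - Num.conj (cis t).
Definition vcirc_inv (t : R) : R[i] := - cis t.

Lemma vcirc_mul t : vcirc_inv t * vcirc t = 1.
Proof. by rewrite /vcirc /vcirc_inv mulrNN cis_conj. Qed.

Lemma normc_vcirc t : normc (vcirc t) = 1.
Proof. by rewrite normcN normc_conj normc_cis. Qed.

Lemma normc_vcirc_inv t : normc (vcirc_inv t) = 1.
Proof. by rewrite normcN normc_cis. Qed.

Lemma circle_mean_monomial k j :
  circle_mean (fun t => vcirc_inv t ^+ k * vcirc t ^+ j) (k == j)%:R.
Proof.
have [jk|kj] := leqP j k.
  have := circle_meanZ ((-1) ^+ (k - j)) (circle_mean_cisX (k - j)).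
  have -> : (-1) ^+ (k - j) * (k - j == 0)%N%:R = (k == j)%:R :> R[i].
    rewrite subn_eq0; have [kj|kj] := leqP k j; last by rewrite gtn_eqF// mulr0.
    have -> : k = j by apply/eqP; rewrite eqn_leq kj.
    by rewrite eqxx subnn mulr1.
  apply: circle_mean_ext => t.
  rewrite -{3}(subnK jk) exprD -mulrA -[X in _ = _ * X]exprMn vcirc_mul expr1n mulr1.
  by rewrite /vcirc_inv [RHS]exprNn.
have := circle_meanZ ((-1) ^+ (j - k)) (circle_mean_conj (circle_mean_cisX (j - k))).
rewrite subn_eq0 leqNgt kj (ltn_eqF kj) conj0 mulr0.
apply: circle_mean_ext => t.
rewrite -{3}(subnK (ltnW kj)) exprD mulrCA -[X in _ = _ * X]exprMn vcirc_mul expr1n mulr1.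
by rewrite /vcirc [RHS]exprNn (rmorphXn (@Num.conj R[i])).
Qed.

Lemma cintegral_dist f g e : ccontinuous f -> ccontinuous g ->
  (forall t, normc (f t - g t) <= e) ->
  normc (cintegral 0 (2 * pi) f - cintegral 0 (2 * pi) g) <= e * (4 * pi).
Proof.
move=> [fr fi] [gr gi] fg; rewrite (le_trans (normc_le_ReIm _))//.
have -> : e * (4 * pi) = e * (2 * pi) + e * (2 * pi) by ring.
rewrite lerD//.
  apply: circle_Rintegral_dist => // t; apply: le_trans (fg t).
  by apply: le_trans (Re_le_normc _); case: (f t) (g t) => ? ? [].
apply: circle_Rintegral_dist => // t; apply: le_trans (fg t).
by apply: le_trans (Im_le_normc _); case: (f t) (g t) => ? ? [].
Qed.

Lemma uniform_continuous_approx (f : R -> R) :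
  (forall e, 0 < e -> exists2 g : R -> R, continuous g & forall t, `|f t - g t| <= e) ->
  continuous f.
Proof.
move=> h t; apply/cvgrPdist_le => e e0.
have e3 : 0 < e / 3 by rewrite divr_gt0.
have [g cg fg] := h _ e3.
have /cvgrPdist_le /(_ _ e3) := cg t.
apply: filterS => s gs.
have -> : f t - f s = (f t - g t) + (g t - g s) + (g s - f s) by ring.
have -> : e = e / 3 + e / 3 + e / 3 by field.
rewrite (le_trans (ler_normD _ _))// lerD//; last by rewrite distrC.
by rewrite (le_trans (ler_normD _ _))// lerD.
Qed.

Lemma ccontinuous_approx (f : R -> R[i]) :
  (forall e, 0 < e -> exists2 g, ccontinuous g & forall t, normc (f t - g t) <= e) ->
  ccontinuous f.
Proof.
move=> h; split; apply: uniform_continuous_approx => e /h [g [gr gi] fg].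
  exists (fun t => complex.Re (g t)) => // t; apply: le_trans (fg t).
  by apply: le_trans (Re_le_normc _); case: (f t) (g t) => ? ? [].
exists (fun t => complex.Im (g t)) => // t; apply: le_trans (fg t).
by apply: le_trans (Im_le_normc _); case: (f t) (g t) => ? ? [].
Qed.

(** The mean passes to uniform limits; that the limit is continuous, hence
    integrable, is part of the claim. *)
Lemma circle_mean_approx (f : R -> R[i]) m :
  (forall e, 0 < e -> exists2 g, circle_mean g m & forall t, normc (f t - g t) <= e) ->
  circle_mean f m.
Proof.
move=> h.
have cf : ccontinuous f.
  by apply: ccontinuous_approx => e /h [g [cg _] fg]; exists g.
split=> //; apply/subr0_eq/eq0_normc/eqP; rewrite eq_le normc_ge0 andbT.
apply: (@le_eps _ _ _ (4 * pi)) => [|e /h [g [cg gm] fg]].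
  by rewrite mulr_ge0// pi_ge0.
by rewrite add0r [leRHS]mulrC -gm cintegral_dist.
Qed.

End CircleMean.

(** * The holomorphic functional calculus on a circle *)

Section CircleCalculus.
Context {R : realType} {W : lmodType R[i]}.
Variable nrm : W -> R.
Hypothesis N : is_seminorm nrm.
Variable K : {linear W -> W}.
Variable k : R.
Hypothesis k0 : 0 <= k.
Hypothesis Kb : forall x, nrm (K x) <= k * nrm x.
Variable G : R[i] -> W -> W.
Hypothesis GL : forall v, normc v <= 1 -> forall x, G v (x - v *: K x) = x.
Hypothesis GR : forall v, normc v <= 1 -> forall x, G v x - v *: K (G v x) = x.
Hypothesis Gb : forall v, normc v <= 1 -> exists M, forall x, nrm (G v x) <= M * nrm x.

(** From some n0 on the powers are contractive; the earlier ones are at most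
    max(1, k)^n0. *)
Lemma power_bounded : exists2 C : R, 0 <= C & forall i x, nrm (iter i K x) <= C * nrm x.
Proof.
have [n0 h] := power_decay N k0 Kb GL GR Gb ltr01.
pose m := Num.max 1 k.
have m1 : 1 <= m by rewrite le_max lexx.
have m0 : 0 <= m by apply: le_trans m1.
have mk : k <= m by rewrite le_max lexx orbT.
exists (m ^+ n0) => [|i x]; first by rewrite exprn_ge0.
have [ni|ni] := leqP n0 i.
  rewrite (le_trans (h i ni x))// ler_wpM2r ?nrm_ge0//; exact: exprn_ege1.
apply: (@le_trans _ _ (m ^+ i * nrm x)); last first.
  by rewrite ler_wpM2r ?nrm_ge0// ler_weXn2l// ltnW.
elim: i {ni} => [|i IH]; first by rewrite expr0 mul1r.
by rewrite iterS (le_trans (Kb _))// exprS -mulrA ler_pM ?nrm_ge0.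
Qed.

Variables (phi : W -> R[i]) (B : R).
Hypothesis phi_lin : forall a x y, phi (a *: x + y) = a * phi x + phi y.
Hypothesis B0 : 0 <= B.
Hypothesis phi_b : forall x, normc (phi x) <= B * nrm x.

Let phiD x y : phi (x + y) = phi x + phi y.
Proof. by have := phi_lin 1 x y; rewrite scale1r mul1r. Qed.

Let phi0 : phi 0 = 0.
Proof. by have := phi_lin (-1) 0 0; rewrite scaler0 addr0 mulN1r addNr. Qed.

Let phiZ a x : phi (a *: x) = a * phi x.
Proof. by have := phi_lin a x 0; rewrite !addr0 phi0 addr0. Qed.

Lemma functional_sum n (u : 'I_n -> W) : phi (\sum_(i < n) u i) = \sum_(i < n) phi (u i).
Proof. exact: (big_morph phi phiD phi0). Qed.

(** The case of polynomials in u = 1 / v of the Riesz-Dunford calculus.  Replacing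
    G v by its geometric sum of length n leaves an error G v (v^n K^n x), small
    uniformly in v; then only the mean of u^i v^j is needed, which is the
    Kronecker symbol. *)
Theorem circle_calculus (p : {poly R}) x :
  circle_mean (fun t => ceval p (vcirc_inv t) * phi (G (vcirc t) x)) (phi (peval K p x)).
Proof.
have [M M0 hM] := resolvent_uniform_bound N k0 Kb GL GR Gb.
apply: circle_mean_approx => e e0.
pose A := poly_l1 p * (B * (M * nrm x)).
have A0 : 0 <= A by rewrite !mulr_ge0 ?poly_l1_ge0 ?nrm_ge0.
have A1 : 0 < A + 1 by rewrite ltr_wpDl.
have [n0 hn] := power_decay N k0 Kb GL GR Gb (divr_gt0 e0 A1).
(* n is at least size p, so that the sum meets every coefficient of p *)
pose n := maxn n0 (size p).
pose a (i : nat) (j : nat) := (p`_i)%:C * phi (iter j K x).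
exists (fun t => \sum_(i < size p) \sum_(j < n) a i j * (vcirc_inv t ^+ i * vcirc t ^+ j)).
  have -> : phi (peval K p x) = \sum_(i < size p) \sum_(j < n) a i j * (val i == val j)%:R.
    rewrite functional_sum; apply: eq_bigr => i _.
    have ni : (i < n)%N by rewrite (leq_trans (ltn_ord i))// leq_maxr.
    rewrite (bigD1 (Ordinal ni)) //= eqxx mulr1 big1 ?addr0 ?phiZ// => j ji.
    by rewrite (_ : (val i == val j) = false) ?mulr0//; apply/negbTE; rewrite eq_sym.
  apply: circle_mean_sum => i; apply: circle_mean_sum => j.
  exact/circle_meanZ/circle_mean_monomial.
move=> t; set u := vcirc_inv t; set v := vcirc t.
have v1 : normc v <= 1 by rewrite normc_vcirc.
have u1 : normc u <= 1 by rewrite normc_vcirc_inv.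
have -> : \sum_(i < size p) \sum_(j < n) a i j * (u ^+ i * v ^+ j) =
    ceval p u * phi (\sum_(j < n) v ^+ j *: iter j K x).
  rewrite ceval_sum functional_sum mulr_suml; apply: eq_bigr => i _.
  rewrite mulr_sumr; apply: eq_bigr => j _; rewrite phiZ /a; ring.
rewrite -mulrBr -(resolvent_geometric GL)//.
have -> : G v x = G v (x - v ^+ n *: iter n K x) + G v (v ^+ n *: iter n K x).
  by rewrite -(resolventD GL GR)// subrK.
rewrite phiD addrC addKr normcM.
apply: (@le_trans _ _ (A * (e / (A + 1)))); last first.
  by rewrite mulrCA ger_pMr// ler_pdivrMr// mul1r lerDl.
have -> : A * (e / (A + 1)) = poly_l1 p * (B * (M * (e / (A + 1) * nrm x))).
  by rewrite /A; ring.
rewrite ler_pM ?normc_ge0 ?ceval_bound// (le_trans (phi_b _))// ler_wpM2l//.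
rewrite (le_trans (hM _ v1 _))// ler_wpM2l// nrmZ// normcX normc_vcirc expr1n mul1r.
by apply: hn; rewrite leq_maxl.
Qed.

End CircleCalculus.

(** * The square root of a bounded self-adjoint operator *)

Section Shift.
Context {R : realType} {W : lmodType R[i]}.
Variables (c r : R) (S : {linear W -> W}).

(** The normalization that moves a spectrum in the disc of centre c and radius r to
    the unit disc. *)
Definition unit_shift (x : W) : W := (r^-1)%:C *: (c%:C *: x - S x).

Lemma unit_shift_is_linear : linear unit_shift.
Proof.
move=> a x y; rewrite /unit_shift (linearP S) [c%:C *: _]scalerDr opprD addrACA.
rewrite scalerDr; congr (_ + _).
rewrite [RHS]scalerA mulrC -scalerA; congr (_ *: _).
by rewrite scalerBr !scalerA [_ * a]mulrC.
Qed.

HB.instance Definition _ := GRing.isLinear.Build R[i] W W *:%R unit_shift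
  unit_shift_is_linear.

Lemma unit_shift_scale x : r != 0 -> r%:C *: unit_shift x = c%:C *: x - S x.
Proof.
move=> r0; rewrite /unit_shift scalerA -(rmorphM (real_complex R)) mulfV//.
by rewrite scale1r.
Qed.

Lemma unit_shiftP v x : r != 0 -> v != 0 ->
  (c%:C - r%:C / v) *: x - S x = - (r%:C / v) *: (x - v *: unit_shift x).
Proof.
move=> r0 v0; rewrite scalerBr scaleNr scalerA mulNr divfK// scaleNr opprK.
by rewrite unit_shift_scale// scalerBl addrA; congr (_ - _); rewrite addrC.
Qed.

End Shift.

Section SquareRoot.
Context {R : realType} {V : lmodType R[i]}.
Variable form : {hermitian V for false & @Num.conj R[i]}.
Variable D : fundamental_decomposition form.
Local Notation nm := (knorm D).
Variables (S P : {linear V -> V}).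
Variable MS : R.
Hypothesis MS0 : 0 <= MS.
Hypothesis Sb : forall x, nm (S x) <= MS * nm x.
Hypothesis S_sa : forall x y, form (S x) y = form x (S y).

Let N := knorm_seminorm D.

Lemma iter_selfadjoint (K : V -> V) : (forall x y, form (K x) y = form x (K y)) ->
  forall n x y, form (iter n K x) y = form x (iter n K y).
Proof.
by move=> h; elim=> // n IH x y; rewrite iterS h IH -iterSr.
Qed.

Lemma peval_selfadjoint (K : {linear V -> V}) (p : {poly R}) :
  (forall x y, form (K x) y = form x (K y)) ->
  forall x y, form (peval K p x) y = form x (peval K p y).
Proof.
move=> h x y; rewrite /peval linear_sumlz linear_sumr /=.
by apply: eq_bigr => i _; rewrite form_Zl form_Zr_real (iter_selfadjoint h).
Qed.

Section Contour.
Variables (c r : R) (Q : R[i] -> {linear V -> V}).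
Hypothesis rc : 0 < r < c.
Hypothesis spec : forall z, spectrum D S z -> normc (z - c%:C) < r.
Hypothesis resQ : forall z, ~ spectrum D S z -> is_resolvent D S z (Q z).
Hypothesis PQ : forall x y, form (P x) y =
  (0 +i* (2 * pi))^-1 * circle_integral c r (fun z => sqrtc z * form (Q z x) y).

Local Notation K := (unit_shift c r S).

Let r0 : 0 < r. Proof. by case/andP: rc. Qed.
Let rn : r != 0. Proof. by rewrite gt_eqF. Qed.
Let c0 : 0 < c. Proof. by case/andP: rc => _; apply: lt_trans. Qed.

(** By [unit_shiftP] this is (I - v K)^-1; v = 0 corresponds to z = infinity. *)
Definition disc_resolvent (v : R[i]) (x : V) : V :=
  if v == 0 then x else - (r%:C / v) *: Q (c%:C - r%:C / v) x.

Local Notation G := disc_resolvent.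

Let outside v : normc v <= 1 -> v != 0 -> is_resolvent D S (c%:C - r%:C / v) (Q (c%:C - r%:C / v)).
Proof.
move=> v1 v0; apply: resQ => /spec; rewrite addrC addKr normcN normcM normcV.
rewrite normc_real gtr0_norm//; apply/negP; rewrite -leNgt ler_pdivlMr.
  by rewrite ger_pMr.
rewrite lt_neqAle normc_ge0 andbT eq_sym; apply: contraNneq v0.
by move/eq0_normc ->.
Qed.

Let GL v : normc v <= 1 -> forall x, G v (x - v *: K x) = x.
Proof.
move=> v1 x; rewrite /G; case: eqVneq => [->|v0]; first by rewrite scale0r subr0.
have [_ _ h] := outside v1 v0.
by rewrite -linearZ_LR -unit_shiftP// h.
Qed.

Let GR v : normc v <= 1 -> forall x, G v x - v *: K (G v x) = x.
Proof.
move=> v1 x; rewrite /G; case: eqVneq => [->|v0]; first by rewrite scale0r subr0.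
have [_ h _] := outside v1 v0.
set w := Q _ _; have -> : v *: K (- (r%:C / v) *: w) = - (r%:C / v) *: (v *: K w).
  by rewrite (linearZ_LR (unit_shift c r S)) [LHS]scalerA [RHS]scalerA [v * _]mulrC.
by rewrite -scalerBr -unit_shiftP// h.
Qed.

Let Gb v : normc v <= 1 -> exists M, forall x, nm (G v x) <= M * nm x.
Proof.
move=> v1; rewrite /G; case: eqVneq => [_|v0].
  by exists 1 => x; rewrite mul1r.
have [[M h] _ _] := outside v1 v0.
exists (normc (- (r%:C / v)) * M) => x; rewrite (nrmZ N) -mulrA ler_wpM2l ?normc_ge0//.
Qed.

Let Kb x : nm (K x) <= r^-1 * (c + MS) * nm x.
Proof.
rewrite /unit_shift (nrmZ N) normc_real gtr0_norm ?invr_gt0// -mulrA.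
rewrite ler_wpM2l ?invr_ge0 ?(ltW r0)// (le_trans (nrmB N _ _))// mulrDl.
by rewrite lerD// (nrmZ N) normc_real gtr0_norm.
Qed.

Let k0 : 0 <= r^-1 * (c + MS).
Proof. by rewrite mulr_ge0 ?invr_ge0 ?addr_ge0// ltW. Qed.

Let K_sa x y : form (K x) y = form x (K y).
Proof.
by rewrite /unit_shift form_Zl form_Zr_real form_Bl form_Br form_Zl form_Zr_real S_sa.
Qed.

(** The change of variable z = c - r / v: the factor r exp(it) of dz turns the
    resolvent of S at z into G v. *)
Lemma contour_integrandE x y t :
  sqrtc (c%:C + r%:C * (cos t +i* sin t)) *
    form (Q (c%:C + r%:C * (cos t +i* sin t)) x) y *
    ((0 +i* r) * (cos t +i* sin t)) =
  'i * (sqrtc (c%:C * (1 - (r / c)%:C * vcirc_inv t)) * form (G (vcirc t) x) y).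
Proof.
rewrite -/(cis t).
have e0 : cis t != 0.
  by apply/eqP => e; have := cis_conj t; rewrite e mul0r => /esym/eqP; rewrite oner_eq0.
have v0 : vcirc t != 0.
  by apply/eqP => e; have := vcirc_mul t; rewrite e mulr0 => /esym/eqP; rewrite oner_eq0.
have vV : (vcirc t)^-1 = - cis t.
  by apply: (mulIf v0); rewrite mulVf//; exact/esym/vcirc_mul.
have -> : c%:C * (1 - (r / c)%:C * vcirc_inv t) = c%:C + r%:C * cis t.
  rewrite mulrBr mulr1 mulrA -(rmorphM (real_complex R)) mulrCA mulfV ?gt_eqF// mulr1.
  by rewrite /vcirc_inv mulrN opprK.
rewrite /G (negbTE v0) vV mulrN opprK form_Zl.
have -> : 0 +i* r = 'i * r%:C :> R[i].
  by apply/eqP; rewrite eq_complex /=; apply/andP; split; apply/eqP; ring.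
ring.
Qed.

(** The integrand for sqrt and the one for p differ by at most eps times a bound on
    G.  Comparing their integrals needs the former to be integrable, which holds
    as it is itself a uniform limit of integrands for polynomials. *)
Lemma square_root_approx : exists2 M : R, 0 <= M &
  forall (eps : R) (p : {poly R}), 0 < eps ->
  (forall u, normc u <= 1 ->
     normc (sqrtc (c%:C * (1 - (r / c)%:C * u)) - ceval p u) <= eps) ->
  forall x, nm (P x - peval K p x) <= M * eps * nm x.
Proof.
have [M M0 hM] := resolvent_uniform_bound N k0 Kb GL GR Gb.
exists (2 * M) => [|eps p e0 hp x]; first by rewrite mulr_ge0.
apply: (@knorm_dual _ _ _ D) => [|y]; first by rewrite !mulr_ge0 ?knorm_ge0 // ltW.
rewrite form_Bl.
pose phi w := form w y.
have phi_b w : normc (phi w) <= nm y * nm w by rewrite mulrC form_bound.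
have phi_lin a u w : phi (a *: u + w) = a * phi u + phi w by exact: form_lin.
pose f t := 'i * (sqrtc (c%:C * (1 - (r / c)%:C * vcirc_inv t)) * phi (G (vcirc t) x)).
pose g (p : {poly R}) t := 'i * (ceval p (vcirc_inv t) * phi (G (vcirc t) x)).
have gm q : circle_mean (g q) ('i * phi (peval K q x)).
  apply: circle_meanZ.
  exact: (circle_calculus N k0 Kb GL GR Gb phi_lin (knorm_ge0 D y) phi_b).
have fg e q : 0 < e -> (forall u, normc u <= 1 ->
     normc (sqrtc (c%:C * (1 - (r / c)%:C * u)) - ceval q u) <= e) ->
     forall t, normc (f t - g q t) <= e * (nm y * (M * nm x)).
  move=> e_gt0 hq t; rewrite /f /g -mulrBr -mulrBl normcM.
  have -> : normc ('i : R[i]) = 1 by rewrite /= expr0n expr1n add0r sqrtr1.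
  rewrite mul1r normcM ler_pM ?normc_ge0//.
    by apply: hq; rewrite normc_vcirc_inv.
  rewrite (le_trans (phi_b _))// ler_wpM2l ?knorm_ge0//.
  by apply: hM; rewrite normc_vcirc.
have B0 : 0 <= nm y * (M * nm x) by rewrite !mulr_ge0 ?knorm_ge0.
have cf : ccontinuous f.
  apply: ccontinuous_approx => e e_gt0.
  have B1 : 0 < nm y * (M * nm x) + 1 by rewrite ltr_wpDl.
  have rc1 : 0 <= r / c < 1.
    by rewrite divr_ge0 ?ltW//= ltr_pdivrMr// mul1r; case/andP: rc.
  have [q [hq _ _]] := sqrt_poly_approx c0 rc1 (divr_gt0 e_gt0 B1).
  exists (g q); first by case: (gm q).
  move=> t; rewrite (le_trans (fg _ q (divr_gt0 e_gt0 B1) hq t))//.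
  by rewrite mulrAC ler_pdivrMr// ler_wpM2l ?lerDl// ltW.
have -> : form (P x) y = (0 +i* (2 * pi))^-1 * cintegral 0 (2 * pi) f.
  rewrite PQ /circle_integral; congr (_ * cintegral _ _ _).
  by apply/funext => t; rewrite contour_integrandE.
have [cg gi] := gm p.
have pi0 : 0 < 2 * pi :> R by rewrite mulr_gt0// pi_gt0.
have iE : 0 +i* (2 * pi) = (2 * pi)%:C * 'i :> R[i].
  by apply/eqP; rewrite eq_complex /=; apply/andP; split; apply/eqP; ring.
have ni : normc (0 +i* (2 * pi) : R[i]) = 2 * pi.
  by rewrite /= expr0n add0r sqrtr_sqr gtr0_norm.
have n0 : (0 +i* (2 * pi) : R[i]) != 0.
  by apply/eqP => e; move: ni; rewrite e normc0 => /esym/eqP; rewrite gt_eqF.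
have -> : form (peval K p x) y = (0 +i* (2 * pi))^-1 * cintegral 0 (2 * pi) (g p).
  have -> : cintegral 0 (2 * pi) (g p) = (0 +i* (2 * pi)) * form (peval K p x) y.
    by rewrite gi iE -[RHS]mulrA.
  by rewrite mulKf.
rewrite -mulrBr normcM normcV ni ler_pdivrMl//.
apply: (le_trans (cintegral_dist cf cg (fg eps p e0 hp))).
rewrite le_eqVlt; apply/orP; left; apply/eqP; ring.
Qed.

Let rho01 : 0 <= r / c < 1.
Proof. by rewrite divr_ge0 ?ltW//= ltr_pdivrMr// mul1r; case/andP: rc. Qed.

Lemma square_root_selfadjoint x y : form (P x) y = form x (P y).
Proof.
have [M M0 hM] := square_root_approx.
apply/subr0_eq/eq0_normc/eqP; rewrite eq_le normc_ge0 andbT.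
apply: (@le_eps _ _ _ (2 * M * nm x * nm y)) => [|e e0].
  by rewrite !mulr_ge0 ?knorm_ge0.
have [p [hp _ _]] := sqrt_poly_approx c0 rho01 e0.
have -> : form (P x) y - form x (P y) =
    form (P x - peval K p x) y - form x (P y - peval K p y).
  by rewrite form_Bl form_Br (peval_selfadjoint _ K_sa) opprB addrA subrK.
rewrite add0r (le_trans (le_normcD _ _))// normcN.
have -> : 2 * M * nm x * nm y * e = M * e * nm x * nm y + nm x * (M * e * nm y) by ring.
rewrite lerD// (le_trans (form_bound D _ _))//.
  by rewrite ler_wpM2r ?knorm_ge0// hM.
by rewrite ler_wpM2l ?knorm_ge0// hM.
Qed.

(** P^2 - S = (P - p(K)) P + p(K) (P - p(K)) + (p(K)^2 - S); the l1 norm of p is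
    bounded independently of eps, and the last term is the residual of p at K. *)
Lemma square_root_sq x : P (P x) = S x.
Proof.
have [M M0 hM] := square_root_approx.
have [C C0 hC] := power_bounded N k0 Kb GL GR Gb.
apply/subr0_eq/(@knorm_eq0 _ _ _ D)/eqP; rewrite eq_le knorm_ge0 andbT.
have q0 : 0 <= M * nm (P x) + 2 * Num.sqrt c * (C * (M * nm x)) + C * nm x.
  by rewrite !addr_ge0 ?mulr_ge0 ?sqrtr_ge0 ?knorm_ge0.
apply: (le_eps q0) => e e0; rewrite add0r.
have [p [hp hres hl1]] := sqrt_poly_approx c0 rho01 e0.
have Pp := hM e p e0 hp.
have SE : S x = peval K (c *: (1 - (r / c) *: 'X)) x.
  rewrite pevalZ pevalD pevalN pevalZ pevalX peval1 scalerBr scalerA.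
  rewrite -(rmorphM (real_complex R)) mulrCA mulfV ?gt_eqF// mulr1.
  by rewrite unit_shift_scale// subKr.
have -> : P (P x) - S x = (P (P x) - peval K p (P x)) + peval K p (P x - peval K p x) +
    peval K (p ^+ 2 - c *: (1 - (r / c) *: 'X)) x.
  rewrite pevalD pevalN -SE expr2 pevalM (pevalB_arg K p).
  by rewrite !addrA !subrK.
have -> : (M * nm (P x) + 2 * Num.sqrt c * (C * (M * nm x)) + C * nm x) * e =
  M * e * nm (P x) + (2 * Num.sqrt c) * (C * (M * e * nm x)) + e * (C * nm x) by ring.
rewrite (le_trans (nrmD N _ _))// lerD//; last first.
  rewrite (le_trans (peval_bound _ N (fun i => hC i x)))// ler_wpM2r//.
  by rewrite mulr_ge0 ?knorm_ge0.
rewrite (le_trans (nrmD N _ _))// lerD//.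
rewrite (le_trans (peval_bound _ N (fun i => hC i _)))//.
by rewrite ler_pM ?poly_l1_ge0 ?mulr_ge0 ?knorm_ge0// ler_wpM2l.
Qed.

End Contour.

End SquareRoot.

Section Main.
Context {R : realType} {V : lmodType R[i]}.
Variable form : {hermitian V for false & @Num.conj R[i]}.
Variable D : fundamental_decomposition form.
Local Notation nm := (knorm D).

Theorem is_sqrt_sq_selfadjoint (S P : {linear V -> V}) : Jframe_operator D S ->
  is_sqrt D S P ->
  (forall x, P (P x) = S x) /\ (forall x y, form (P x) y = form x (P y)).
Proof.
move=> [I [F [T [[bF _ _] hT TS]]]] [_ [c [r [Q [rc spec resQ PQ]]]]].
have [MS MS0 Sb] := TTp_bounded bF hT TS.
have S_sa := TTp_selfadjoint TS.
split=> [x|x y].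
  exact: (square_root_sq MS0 Sb rc spec resQ PQ).
exact: (square_root_selfadjoint MS0 Sb S_sa rc spec resQ PQ).
Qed.

(** 0 is outside of the contour, so the resolvent Q 0 = - S^-1 is bounded, and
    P (- Q 0) is a bounded inverse of P. *)
Lemma is_sqrt_inverse (S P : {linear V -> V}) : is_sqrt D S P ->
  (forall x, P (P x) = S x) ->
  exists Pi : {linear V -> V},
  [/\ bounded_op nm nm Pi, (forall x, P (Pi x) = x) & (forall x, Pi (P x) = x)].
Proof.
move=> [[MP hP] [c [r [Q [/andP[r0 rc] spec resQ _]]]]] PP.
have [|[MQ hQ] SQ QS] := resQ 0.
  move=> /spec; rewrite sub0r normcN normc_real gtr0_norm ?(lt_trans r0)//.
  by rewrite ltNge (ltW rc).
have {}SQ x : S (- Q 0 x) = x.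
  by rewrite linearN /=; have := SQ x; rewrite scale0r sub0r.
have {}QS x : - Q 0 (S x) = x.
  by have := QS x; rewrite scale0r sub0r linearN.
have Pinj x y : P x = P y -> x = y.
  by move=> e; rewrite -[x]QS -[y]QS -!PP e.
have PL x : P (- P (Q 0 x)) = x.
  by rewrite -[RHS]SQ -PP !linearN.
exists (\- (P \o Q 0)); split => [|x|x] /=.
- exists (`|MP| * `|MQ|) => x; have N := knorm_seminorm D.
  rewrite (nrmN N) (le_trans (hP _))// -mulrA.
  apply: (@le_trans _ _ (`|MP| * nm (Q 0 x))).
    by rewrite ler_wpM2r ?ler_norm ?knorm_ge0.
  by rewrite ler_wpM2l// (le_trans (hQ _))// ler_wpM2r ?ler_norm ?knorm_ge0.
- exact: PL.
- by apply: Pinj; rewrite PL.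
Qed.

End Main.

Theorem corollary6p5 (R : realType) (V : lmodType R[i])
    (form : {hermitian V for false & @Num.conj R[i]})
    (D : fundamental_decomposition form)
    (S : {linear V -> V}) (hS : Jframe_operator D S)
    (sqrtS : {linear V -> V}) (hsqrtS : is_sqrt D S sqrtS)
    (I : choiceType) (F : I -> V) (hF : Jframe D F)
    (T : {linear ell2 R I -> V}) (hT : is_synthesis D F T) :
  factors_as_TTp form F T S <->
  exists U : {linear ell2 R I -> V},
    coisometry (ell2_form form F) form (@ell2_norm R I) (knorm D) U /\
    forall x, T x = sqrtS (U x).
Proof.
have [PP P_sa] := is_sqrt_sq_selfadjoint hS hsqrtS.
have [Pi [[MPi hPi] PPi PiP]] := is_sqrt_inverse hsqrtS PP.
split=> [[Tp TTp ST]|[U [[_ [Up UUp UpK]] TU]]].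
  exists (Pi \o T); split; last by move=> x /=; rewrite PPi.
  split.
    have [bF _ _] := hF; have [M M0 hM] := synthesis_bounded bF hT.
    exists (`|MPi| * M) => x /=; rewrite (le_trans (hPi _))//.
    apply: (@le_trans _ _ (`|MPi| * knorm D (T x))).
      by rewrite ler_wpM2r ?ler_norm ?knorm_ge0.
    by rewrite -mulrA ler_wpM2l.
  exists (Tp \o Pi) => [x y|y] /=.
    by rewrite -TTp -[in LHS](PPi y) -P_sa PPi.
  by rewrite -ST -PP PiP PPi.
exists (Up \o sqrtS) => [x y|f] /=.
  by rewrite TU P_sa UUp.
by rewrite TU UpK PP.
Qed.
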